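(* Let $n$ be a positive integer and $\lambda$ a partition with $n$ or fewer parts. The natural bijection $\mathcal T:\mathrm{GTP}(n,\lambda)\to\mathrm{SSYT}(n,\lambda)$ from Gelfand-Tsetlin patterns to semistandard Young tableaux (which sends $\Lambda$ to the tableau with $i$ in every box of the skew diagram $\lambda^{(i)}/\lambda^{(i-1)}$, $i=1,\dots,n$), extended by $\mathcal T(0)=0$, is an isomorphism of crystals of type $A_{n-1}$, where $\mathrm{GTP}(n,\lambda)$ and $\mathrm{SSYT}(n,\lambda)$ carry the crystal structures defined in the context.
   Context: **Cartan datum of type $A_{n-1}$.** The index set is $I=\{1,2,\dots,n-1\}$. The weight lattice $P$ is the abelian group generated by $\boldsymbol e_1,\dots,\boldsymbol e_n$ subject to $\boldsymbol e_1+\cdots+\boldsymbol e_n=0$. For $i\in I$, $\alpha_i=\boldsymbol e_i-\boldsymbol e_{i+1}$, and $\alpha_j^\vee\in\mathrm{Hom}_{\mathbb Z}(P,\mathbb Z)$ is given by $\langle \boldsymbol e_i,\alpha_j^\vee\rangle=\delta_{ij}-\delta_{i,j+1}$. **Crystal.** A crystal of type $A_{n-1}$ is a non-empty set $\mathcal B$ together with maps $\mathrm{wt}:\mathcal B\to P$, $\widetilde e_i,\widetilde f_i:\mathcal B\to\mathcal B\sqcup\{0\}$ and $\varepsilon_i,\varphi_i:\mathcal B\to\mathbb Z\sqcup\{-\infty\}$ ($i\in I$) such that for all $b,b'\in\mathcal B$ and $i\in I$: (i) $\widetilde f_i(b)=b'$ if and only if $b=\widetilde e_i(b')$, in which case $\mathrm{wt}(b')=\mathrm{wt}(b)-\alpha_i$,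 $\varepsilon_i(b')=\varepsilon_i(b)+1$, $\varphi_i(b')=\varphi_i(b)-1$, and one writes $b\overset{i}{\longrightarrow}b'$; (ii) $\varphi_i(b)=\varepsilon_i(b)+\langle\mathrm{wt}(b),\alpha_i^\vee\rangle$ (in particular $\varphi_i(b)=-\infty$ iff $\varepsilon_i(b)=-\infty$); (iii) if $\varphi_i(b)=\varepsilon_i(b)=-\infty$ then $\widetilde e_i(b)=\widetilde f_i(b)=0$. **Isomorphism.** A morphism $\mathcal B_1\to\mathcal B_2$ of crystals is a map $\Psi:\mathcal B_1\sqcup\{0\}\to\mathcal B_2\sqcup\{0\}$ with $\Psi(0)=0$ such that for all $b,b'\in\Psi^{-1}(\mathcal B_2)$ and $i\in I$: $\mathrm{wt}(\Psi(b))=\mathrm{wt}(b)$, $\varepsilon_i(\Psi(b))=\varepsilon_i(b)$, $\varphi_i(\Psi(b))=\varphi_i(b)$; and if $b\overset{i}{\longrightarrow}b'$ then $\Psi(b)\overset{i}{\longrightarrow}\Psi(b')$. It is an isomorphism if moreover $\Psi$ is bijective as a map $\mathcal B_1\sqcup\{0\}\to\mathcal B_2\sqcup\{0\}$. **Gelfand-Tsetlin patterns.** A partition is a sequence $\lambda=(\lambda_1\ge\lambda_2\ge\cdots\ge 0)$ of integers with finite sum $|\lambda|$; its parts are its nonzero entries. A Gelfand-Tsetlin pattern with $n$ rows and top row $\lambda$ is a triangular array $\Lambda=(\lambda^{(i)}_j)_{1\le j\le i\le n}$ of non-negative integers with $\lambda^{(i+1)}_j\ge\lambda^{(i)}_j\ge\lambda^{(i+1)}_{j+1}$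 for $1\le j\le i\le n-1$, and $\lambda^{(n)}_i=\lambda_i$ for $1\le i\le n$. By convention $\lambda^{(i)}_j=0$ unless $1\le j\le i\le n$. The set of these patterns is $\mathrm{GTP}(n,\lambda)$. Row $i$ is viewed as the partition $\lambda^{(i)}=(\lambda^{(i)}_1,\dots,\lambda^{(i)}_i)$; $\lambda^{(0)}$ is the empty partition. **Crystal structure on $\mathrm{GTP}(n,\lambda)$.** For $i\in\{1,\dots,n-1\}$ put $$a^{(i)}_j(\Lambda)=\lambda^{(i)}_j-\lambda^{(i-1)}_j+\lambda^{(i)}_{j+1}-\lambda^{(i+1)}_{j+1}\quad(0\le j\le i),$$ $$b^{(i)}_j(\Lambda)=-\lambda^{(i)}_j+\lambda^{(i-1)}_{j-1}-\lambda^{(i)}_{j-1}+\lambda^{(i+1)}_j\quad(1\le j\le i+1),$$ $$A^{(i)}_j(\Lambda)=\sum_{k=j}^i a^{(i)}_k(\Lambda)\quad(0\le j\le i),\qquad B^{(i)}_j(\Lambda)=\sum_{k=1}^j b^{(i)}_k(\Lambda)\quad(1\le j\le i+1).$$ Let $\Lambda\pm\Delta^{(i)}_j$ be the array obtained from $\Lambda$ by replacing $\lambda^{(i)}_j$ by $\lambda^{(i)}_j\pm1$. Define $$\mathrm{wt}(\Lambda)=\sum_{j=1}^n\Big(\sum_{k=1}^j\lambda^{(j)}_k-\sum_{k=1}^{j-1}\lambda^{(j-1)}_k\Big)\boldsymbol e_j,$$ $$\varphi_i(\Lambda)=\max\{A^{(i)}_1(\Lambda),\dots,A^{(i)}_i(\Lambda)\},\qquad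 \varepsilon_i(\Lambda)=\max\{B^{(i)}_1(\Lambda),\dots,B^{(i)}_i(\Lambda)\}.$$ - $\widetilde f_i(\Lambda)=\Lambda-\Delta^{(i)}_\ell$ if $\varphi_i(\Lambda)>0$, where $\ell=\max\{j\in\{1,\dots,i\}\mid A^{(i)}_j(\Lambda)=\varphi_i(\Lambda)\}$; and $\widetilde f_i(\Lambda)=0$ if $\varphi_i(\Lambda)=0$. - $\widetilde e_i(\Lambda)=\Lambda+\Delta^{(i)}_\ell$ if $\varepsilon_i(\Lambda)>0$, where $\ell=\min\{j\in\{1,\dots,i\}\mid B^{(i)}_j(\Lambda)=\varepsilon_i(\Lambda)\}$; and $\widetilde e_i(\Lambda)=0$ if $\varepsilon_i(\Lambda)=0$. With these maps $\mathrm{GTP}(n,\lambda)$ is a crystal of type $A_{n-1}$. **Semistandard Young tableaux.** The Young diagram of $\lambda$ is the left-justified array of boxes with $\lambda_k$ boxes in row $k$ (rows numbered from the top). $\mathrm{SSYT}(n,\lambda)$ is the set of fillings of this diagram with entries in $\{1,\dots,n\}$ that weakly increase from left to right along rows and strictly increase from top to bottom down columns. **Crystal structure on $\mathrm{SSYT}(n,\lambda)$.** For $T\in\mathrm{SSYT}(n,\lambda)$, $\mathrm{FarEast}(T)$ is the $|\lambda|$-tuple of entries of $T$ obtained by reading the columns from right to left, each column from top to bottom. The map $\mathrm{FarEast}$ is injective, and $\mathrm{FarEast}^{-1}$ denotes its inverse on its image. For $i\in\{1,\dots,n-1\}$, the $i$-bracketing $[x]_i$ of a tuple $x$ of letters is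 obtained by crossing out the rightmost $i$ that has at least one $i+1$ somewhere to its right, together with the leftmost of those $(i+1)$'s, and repeating this recursively (ignoring crossed-out entries) until $(i,i+1)$ is no longer a subsequence of the remaining entries. Letters $i$ and $i+1$ that are not crossed out are called unbracketed. Define - $\mathrm{wt}(T)=\sum_{k=1}^n N_k(T)\boldsymbol e_k$, where $N_k(T)$ is the number of boxes of $T$ containing $k$; - $\varphi_i(T)$ = number of unbracketed $i$'s in $[\mathrm{FarEast}(T)]_i$; $\varepsilon_i(T)$ = number of unbracketed $(i+1)$'s in $[\mathrm{FarEast}(T)]_i$; - $\widetilde f_i(T)$ = $\mathrm{FarEast}^{-1}$ of the tuple obtained from $\mathrm{FarEast}(T)$ by changing the leftmost unbracketed $i$ to $i+1$ if $\varphi_i(T)>0$, and $\widetilde f_i(T)=0$ otherwise; - $\widetilde e_i(T)$ = $\mathrm{FarEast}^{-1}$ of the tuple obtained from $\mathrm{FarEast}(T)$ by changing the rightmost unbracketed $i+1$ to $i$ if $\varepsilon_i(T)>0$, and $\widetilde e_i(T)=0$ otherwise. It is known that with these maps $\mathrm{SSYT}(n,\lambda)$ is a crystal of type $A_{n-1}$. **The bijection $\mathcal T$.** Given $\Lambda\in\mathrm{GTP}(n,\lambda)$, $\mathcal T(\Lambda)\in\mathrm{SSYT}(n,\lambda)$ is obtained by inserting $i$ into the boxes of the skew diagram $\lambda^{(i)}/\lambda^{(i-1)}$ for $i=1,\dots,n$. The inverse sends $T$ to the pattern whose $i$-th row $\lambda^{(i)}$ is the shape of the tableau obtained from $T$ by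 deleting all boxes with entries larger than $i$. *)

(* Defs.v *)
From HB Require Import structures.
From mathcomp Require Import all_boot all_order all_algebra.
From mathcomp Require Import zify.

Set Implicit Arguments.
Unset Strict Implicit.
Unset Printing Implicit Defensive.

Import Order.TTheory GRing.Theory Num.Theory.

Local Open Scope quotient_scope.
Local Open Scope ring_scope.

(** * The Cartan datum of type A_(n-1)

    The index set I = {1, .., n-1} is represented by 'I_n.-1, the ordinal i
    standing for the index i.+1.  Everywhere else (the vectors e_k, rows and
    columns of arrays, letters) the indices are natural numbers counted from 1,
    as in the mathematics. *)

Section WeightLattice.
Variable n : nat.

Definition diag_vec (v : 'rV[int]_n) : bool :=
  [forall i, forall j, v 0 i == v 0 j].

Lemma diag_vecP v : reflect (exists c : int, v = const_mx c) (v \in diag_vec).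
Proof.
apply: (iffP idP) => [/forallP vP | [c ->]]; last first.
  by apply/forallP => i; apply/forallP => j; rewrite !mxE.
have [n0 | n_gt0] := posnP n.
  by exists 0; apply/rowP => -[m lt_m]; exfalso; move: lt_m; rewrite n0.
exists (v 0 (Ordinal n_gt0)); apply/rowP => i; rewrite mxE.
exact/eqP/(forallP (vP i)).
Qed.

Lemma diag_vec_zmod_closed : zmod_closed diag_vec.
Proof.
split; first by apply/diag_vecP; exists 0.
move=> u v /diag_vecP[c ->] /diag_vecP[d ->]; apply/diag_vecP.
by exists (c - d); apply/rowP => i; rewrite !mxE.
Qed.

HB.instance Definition _ :=
  GRing.isZmodClosed.Build 'rV[int]_n diag_vec diag_vec_zmod_closed.

(* Z^n modulo the line spanned by (1, .., 1) *)
Definition weight := Quotient.quot (GRing.ZmodClosed.clone _ diag_vec _).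

HB.instance Definition _ := EqQuotient.on weight.
HB.instance Definition _ := Choice.on weight.
HB.instance Definition _ := GRing.Zmodule.on weight.
HB.instance Definition _ := ZmodQuotient.on weight.

Definition evec (k : nat) : weight :=
  \pi_weight (\row_(j < n) ((j.+1 == k)%:R : int)).

Definition alpha (i : 'I_n.-1) : weight := evec i.+1 - evec i.+2.

Definition coroot_vec (i : 'I_n.-1) (v : 'rV[int]_n) : int :=
  \sum_(k < n) v 0 k * ((k.+1 == i.+1)%:R - (k.+1 == i.+2)%:R).

Definition coroot (i : 'I_n.-1) (x : weight) : int := coroot_vec i (repr x).

Lemma evec_sum0 : \sum_(1 <= k < n.+1) evec k = 0.
Proof.
rewrite /evec -raddf_sum /= -(raddf0 \pi_weight); apply/eqP.
rewrite -Quotient.idealrBE subr0; apply/diag_vecP; exists 1; apply/rowP => j.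
rewrite summxE mxE (bigD1_seq j.+1) ?iota_uniq ?mem_index_iota ?ltnS //=.
by rewrite mxE eqxx big1 ?addr0 // => k /negPf kj; rewrite mxE eq_sym kj.
Qed.

Lemma coroot_vecB i : {morph coroot_vec i : u v / u - v}.
Proof.
move=> u v; rewrite /coroot_vec -sumrB; apply: eq_bigr => k _.
by rewrite !mxE mulrBl.
Qed.

Lemma coroot_diag i v : v \in diag_vec -> coroot_vec i v = 0.
Proof.
case/diag_vecP=> c ->; rewrite /coroot_vec.
under eq_bigr do rewrite mxE; rewrite -mulr_sumr sumrB.
have sum1 (m : nat) : (m < n)%N -> \sum_(k < n) ((k.+1 == m.+1)%:R : int) = 1.
  move=> lt_m; rewrite (bigD1 (Ordinal lt_m)) //= eqxx big1 ?addr0 // => k.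
  by rewrite -val_eqE /= eqSS => /negPf->.
by have := ltn_ord i => lt_i; rewrite !sum1 ?subrr ?mulr0 //; lia.
Qed.

Lemma coroot_pi i (v : 'rV[int]_n) : coroot i (\pi_weight v) = coroot_vec i v.
Proof.
apply/eqP; rewrite -subr_eq0 -coroot_vecB; apply/eqP/coroot_diag.
by rewrite Quotient.idealrBE reprK.
Qed.

Lemma coroot_is_zmod_morphism i : zmod_morphism (coroot i).
Proof.
move=> x y; rewrite -[x]reprK -[y]reprK -raddfB !coroot_pi.
exact: coroot_vecB.
Qed.

HB.instance Definition _ (i : 'I_n.-1) :=
  GRing.isZmodMorphism.Build weight int (coroot i) (coroot_is_zmod_morphism i).

Lemma coroot_evec i k : (0 < k <= n)%N ->
  coroot i (evec k) = (k == i.+1)%:R - (k == i.+2)%:R.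
Proof.
case: k => // k /= lt_k; rewrite coroot_pi /coroot_vec.
rewrite (bigD1 (Ordinal lt_k)) //= mxE eqxx mul1r big1 ?addr0 // => j.
by rewrite -val_eqE mxE eqSS /= => /negPf->; rewrite mul0r.
Qed.

End WeightLattice.

(** * Crystals

    [None] encodes the element -oo in the codomain of eps and phi, and the
    element 0 adjoined to a crystal in the codomain of e and f and in the
    source and target of morphisms. *)

Record crystal_data (n : nat) := CrystalData {
  carrier :> Type;
  wt  : carrier -> weight n;
  e_  : 'I_n.-1 -> carrier -> option carrier;
  f_  : 'I_n.-1 -> carrier -> option carrier;
  eps : 'I_n.-1 -> carrier -> option int;
  phi : 'I_n.-1 -> carrier -> option int
}.

Definition arrow n (B : crystal_data n) (i : 'I_n.-1) (b b' : B) : Prop :=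
  f_ i b = Some b'.

Record is_crystal n (B : crystal_data n) : Prop := IsCrystal {
  crystal_nonempty : inhabited B;
  crystal_fe : forall (b b' : B) i, f_ i b = Some b' <-> Some b = e_ i b';
  crystal_arrow : forall (b b' : B) i, arrow i b b' ->
    [/\ wt b' = wt b - alpha i,
        eps i b' = omap (fun m => m + 1) (eps i b)
      & phi i b' = omap (fun m => m - 1) (phi i b)];
  crystal_phi_eps : forall (b : B) i,
    phi i b = omap (fun m => m + coroot i (wt b)) (eps i b);
  crystal_ninfty : forall (b : B) i,
    phi i b = None -> eps i b = None -> e_ i b = None /\ f_ i b = None
}.

Record crystal_morphism n (B1 B2 : crystal_data n)
    (Psi : option B1 -> option B2) : Prop := CrystalMorphism {
  morphism0 : Psi None = None;
  morphism_stat : forall (b : B1) (c : B2), Psi (Some b) = Some c ->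
    wt c = wt b /\ (forall i, eps i c = eps i b /\ phi i c = phi i b);
  morphism_arrow : forall (b b' : B1) (c c' : B2) i,
    Psi (Some b) = Some c -> Psi (Some b') = Some c' ->
    arrow i b b' -> arrow i c c'
}.

Definition crystal_isomorphism n (B1 B2 : crystal_data n)
    (Psi : option B1 -> option B2) : Prop :=
  crystal_morphism Psi /\ bijective Psi.

(** * Partitions and arrays

    A partition is the list of its parts, and an array (Gelfand-Tsetlin pattern
    or tableau) is the list of its rows.  All accessors count from 1 and return
    0 out of range, which is the convention for partitions and for patterns. *)

Definition is_part (la : seq nat) : bool := sorted geq la && (0%N \notin la).

Definition part (la : seq nat) (k : nat) : nat := nth 0%N (0%N :: la) k.

Definition arow (M : seq (seq nat)) (i : nat) : seq nat :=
  nth [::] ([::] :: M) i.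

Definition ent (M : seq (seq nat)) (i j : nat) : nat := part (arow M i) j.

(* The indices are expected to be positive. *)
Definition upd (M : seq (seq nat)) (i j x : nat) : seq (seq nat) :=
  set_nth [::] M i.-1 (set_nth 0%N (arow M i) j.-1 x).

Lemma part_oversize la k : (size la < k)%N -> part la k = 0%N.
Proof. by move=> ?; rewrite /part nth_default. Qed.

Lemma ent_upd M i j x i' j' : (0 < i)%N -> (0 < j)%N ->
  ent (upd M i j x) i' j' = if (i' == i) && (j' == j) then x else ent M i' j'.
Proof.
case: i j => [|i] [|j] // _ _; rewrite /ent /upd /arow /part /=.
case: i' => [|i'] /=; first by case: j'.
rewrite nth_set_nth /= eqSS; case: eqP => [->|_] //=.
by case: j' => [|j'] //=; rewrite nth_set_nth /= eqSS.
Qed.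

Lemma shape_upd M i j x : (0 < i <= size M)%N -> (0 < j <= size (arow M i))%N ->
  shape (upd M i j x) = shape M.
Proof.
case: i j => [|i] [|j] //=; rewrite /arow /upd /= => le_i le_j.
apply: (@eq_from_nth _ 0%N) => [|k].
  by rewrite !size_map size_set_nth; apply/maxn_idPr.
rewrite size_map size_set_nth (maxn_idPr le_i) => lt_k.
rewrite !(nth_map [::]) ?size_set_nth ?(maxn_idPr le_i) // nth_set_nth /=.
by case: eqP => [->|//]; rewrite size_set_nth; apply/maxn_idPr.
Qed.

(** * Gelfand-Tsetlin patterns *)

Definition is_gtp (n : nat) (la : seq nat) (L : seq (seq nat)) : bool :=
  [&& shape L == iota 1 n,
      all (fun i => all (fun j =>
        (ent L i.+1 j >= ent L i j) && (ent L i j >= ent L i.+1 j.+1))%N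
        (iota 1 i)) (iota 1 n.-1)
    & all (fun i => ent L n i == part la i) (iota 1 n)].

Definition gtp (n : nat) (la : seq nat) : Type :=
  {L : seq (seq nat) | is_gtp n la L}.

Section GTTheory.
Variables (n : nat) (la : seq nat) (L : seq (seq nat)).
Hypothesis gtpL : is_gtp n la L.

Lemma gtp_size : size L = n.
Proof.
by case/and3P: gtpL => /eqP/(congr1 size); rewrite size_map size_iota.
Qed.

Lemma gtp_size_row i : (0 < i <= n)%N -> size (arow L i) = i.
Proof.
case: i => // i /= lt_i; rewrite /arow /= -(nth_shape L).
by case/and3P: gtpL => /eqP-> _ _; rewrite nth_iota.
Qed.

Lemma gtp_ent0 i j : (i < j)%N || (n < i)%N -> ent L i j = 0%N.
Proof.
have part0 : part [::] j = 0%N by rewrite /part; case: (j) => [|[]].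
case: i => [|i] ij //; have [le_i | lt_i] := leqP i.+1 n; last first.
  by rewrite /ent (_ : arow L i.+1 = [::]) // /arow nth_default //= gtp_size.
rewrite /ent part_oversize // gtp_size_row //.
by move: ij; rewrite [(n < _)%N]ltnNge le_i orbF.
Qed.

Lemma gtp_interlace i j : (0 < j <= i)%N -> (i < n)%N ->
  (ent L i.+1 j.+1 <= ent L i j <= ent L i.+1 j)%N.
Proof.
move=> j_i lt_i; case/and3P: gtpL => _ /allP /(_ i) H _.
have /H /allP/(_ j) {}H : i \in iota 1 n.-1 by rewrite mem_iota; lia.
by have /H : j \in iota 1 i; rewrite 1?andbC // mem_iota; lia.
Qed.

Lemma gtp_top i : (0 < i <= n)%N -> ent L n i = part la i.
Proof.
case/and3P: gtpL => _ _ /allP /(_ i); rewrite mem_iota => H i_n.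
by apply/eqP/H; lia.
Qed.

Lemma gtp_upd i l x : (0 < i < n)%N -> (0 < l <= i)%N ->
    (ent L i.+1 l.+1 <= x <= ent L i.+1 l)%N ->
    ((l < i)%N -> (x >= ent L i.-1 l)%N) ->
    ((1 < l)%N -> (x <= ent L i.-1 l.-1)%N) ->
  is_gtp n la (upd L i l x).
Proof.
move=> i_n l_i xup xlo1 xlo2; have [i0 l0] : (0 < i /\ 0 < l)%N by lia.
apply/and3P; split.
- rewrite shape_upd ?gtp_size ?gtp_size_row; try lia.
  by case/and3P: gtpL.
- apply/allP => a; rewrite mem_iota => a_n; apply/allP => b; rewrite mem_iota => b_a.
  rewrite !ent_upd //; have ab := @gtp_interlace a b; apply/andP; split.
  + case: ifP => [/andP[/eqP ai /eqP bl]|_].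
      by subst a b; rewrite ifF; lia.
    case: ifP => [/andP[/eqP ai /eqP bl]|_]; last by lia.
    by subst l i; apply: xlo1; lia.
  + case: ifP => [/andP[/eqP ai /eqP bl]|_].
      by subst l i; rewrite ifF; [apply: xlo2; lia | lia].
    case: ifP => [/andP[/eqP ai /eqP bl]|_]; last by lia.
    by subst a b; lia.
apply/allP => j; rewrite mem_iota => j_n; rewrite ent_upd // ifF; last by lia.
by rewrite gtp_top //; lia.
Qed.

End GTTheory.

Lemma bigmax_attained (F : nat -> int) i : (0 < i)%N ->
  exists2 j, (0 < j <= i)%N & \big[Num.max/F 1%N]_(1 <= j < i.+1) F j = F j.
Proof.
move=> i0; rewrite big_seq.
elim/big_rec: _ => [|j x]; first by exists 1%N.
rewrite mem_index_iota => j_i [k k_i ->].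
by case: leP => _; [exists k | exists j].
Qed.

Lemma bigmax_ge (F : nat -> int) i j : (0 < j <= i)%N ->
  F j <= \big[Num.max/F 1%N]_(1 <= j < i.+1) F j.
Proof. by move=> ?; apply: le_bigmax_seq; rewrite ?mem_index_iota. Qed.

Lemma last_filter_iota (p : pred nat) m l x :
    x \in iota m l -> p x ->
  let k := last 0%N [seq j <- iota m l | p j] in
  [/\ k \in iota m l, p k & forall j, j \in iota m l -> p j -> (j <= k)%N].
Proof.
move=> xl px /=; set s := filter _ _; have xs : x \in s by rewrite mem_filter px.
have ks : last 0%N s \in s by case: (s) xs => //= a t _; apply: mem_last.
have := ks; rewrite {1}mem_filter => /andP[pk kl]; split=> // j jl pj.
have js : j \in s by rewrite mem_filter pj.
have /(sorted_leq_nth leq_trans leqnn) : sorted leq s.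
  by apply: (sorted_filter leq_trans); apply: iota_sorted.
move=> /(_ 0%N) sP; rewrite -(nth_index 0%N js) -nth_last; apply: sP.
- by rewrite inE index_mem.
- by rewrite inE; case: (s) js.
by rewrite -ltnS prednK ?index_mem //; case: (s) js.
Qed.

Lemma head_filter_iota (p : pred nat) m l x :
    x \in iota m l -> p x ->
  let k := head 0%N [seq j <- iota m l | p j] in
  [/\ k \in iota m l, p k & forall j, j \in iota m l -> p j -> (k <= j)%N].
Proof.
move=> xl px /=; set s := filter _ _; have xs : x \in s by rewrite mem_filter px.
have ks : head 0%N s \in s by case: (s) xs => //= a t _; apply: mem_head.
have := ks; rewrite {1}mem_filter => /andP[pk kl]; split=> // j jl pj.
have js : j \in s by rewrite mem_filter pj.
have : sorted leq s by apply: (sorted_filter leq_trans); apply: iota_sorted.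
move: js; case: (s) => //= a t; rewrite inE => /orP[/eqP->//|jt].
by move=> /(order_path_min leq_trans)/allP/(_ j jt).
Qed.

Section GTOperators.
Variable L : seq (seq nat).

Definition gt_a (i j : nat) : int :=
  (ent L i j)%:Z - (ent L i.-1 j)%:Z
    + (ent L i j.+1)%:Z - (ent L i.+1 j.+1)%:Z.

Definition gt_b (i j : nat) : int :=
  - (ent L i j)%:Z + (ent L i.-1 j.-1)%:Z
    - (ent L i j.-1)%:Z + (ent L i.+1 j)%:Z.

Definition gt_A (i j : nat) : int := \sum_(j <= k < i.+1) gt_a i k.

Definition gt_B (i j : nat) : int := \sum_(1 <= k < j.+1) gt_b i k.

Definition gt_phi (i : nat) : int :=
  \big[Num.max/gt_A i 1]_(1 <= j < i.+1) gt_A i j.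

Definition gt_eps (i : nat) : int :=
  \big[Num.max/gt_B i 1]_(1 <= j < i.+1) gt_B i j.

Definition gt_f_pos (i : nat) : nat :=
  last 0%N [seq j <- iota 1 i | gt_A i j == gt_phi i].

Definition gt_e_pos (i : nat) : nat :=
  head 0%N [seq j <- iota 1 i | gt_B i j == gt_eps i].

Definition gt_f_arr (i : nat) : seq (seq nat) :=
  let l := gt_f_pos i in upd L i l (ent L i l - 1).

Definition gt_e_arr (i : nat) : seq (seq nat) :=
  let l := gt_e_pos i in upd L i l (ent L i l + 1).

Definition gt_wt (n : nat) : weight n :=
  \sum_(1 <= j < n.+1) evec n j *~
    ((\sum_(1 <= k < j.+1) ent L j k)%N%:Z
       - (\sum_(1 <= k < j) ent L j.-1 k)%N%:Z).

End GTOperators.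

Lemma gt_f_def n la L i : is_gtp n la L -> (0 < i < n)%N ->
  0 < gt_phi L i -> is_gtp n la (gt_f_arr L i).
Proof.
move=> gtpL i_n phi0; have i0 : (0 < i)%N by lia.
have [x x_i phix] := bigmax_attained (gt_A L i) i0.
have := @last_filter_iota (fun j => gt_A L i j == gt_phi L i) 1 i x.
rewrite mem_iota [gt_phi _ _]phix eqxx /= add1n ltnS => /(_ x_i isT).
rewrite -[gt_A L i x]phix -/(gt_phi L i) -/(gt_f_pos L i).
rewrite /gt_f_arr; set l := gt_f_pos L i => -[].
rewrite mem_iota add1n ltnS => l_i /eqP phil maxl.
have /andP[l0 le_l] := l_i.
have Al : gt_A L i l = gt_a L i l + gt_A L i l.+1.
  by rewrite /gt_A big_ltn //; lia.
have a_gt0 : 0 < gt_a L i l.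
  have [lt_l | ge_l] := ltnP l i; last first.
    have -> : gt_a L i l = gt_A L i l; last by rewrite phil.
    by rewrite Al [gt_A _ _ l.+1]/gt_A big_geq ?addr0 //; lia.
  have : gt_A L i l.+1 < gt_phi L i.
    rewrite lt_neqAle (bigmax_ge (gt_A L i)) ?andbT; last by lia.
    apply/negP=> /(maxl l.+1); rewrite mem_iota; lia.
  by rewrite -phil Al; lia.
have H1 := @gtp_interlace _ _ _ gtpL i l; have H2 := @gtp_interlace _ _ _ gtpL i l.+1.
have H3 := @gtp_interlace _ _ _ gtpL i.-1 l; have H4 := @gtp_interlace _ _ _ gtpL i.-1 l.-1.
have H5 := @gtp_ent0 _ _ _ gtpL i l.+1; have H6 := @gtp_ent0 _ _ _ gtpL i.-1 l.
rewrite /gt_a in a_gt0; rewrite !prednK // in H3 H4.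
by apply: gtp_upd => //; lia.
Qed.

Lemma gt_e_def n la L i : is_gtp n la L -> (0 < i < n)%N ->
  0 < gt_eps L i -> is_gtp n la (gt_e_arr L i).
Proof.
move=> gtpL i_n eps0; have i0 : (0 < i)%N by lia.
have [x x_i epsx] := bigmax_attained (gt_B L i) i0.
have := @head_filter_iota (fun j => gt_B L i j == gt_eps L i) 1 i x.
rewrite mem_iota [gt_eps _ _]epsx eqxx /= add1n ltnS => /(_ x_i isT).
rewrite -[gt_B L i x]epsx -/(gt_eps L i) -/(gt_e_pos L i).
rewrite /gt_e_arr; set l := gt_e_pos L i => -[].
rewrite mem_iota add1n ltnS => l_i /eqP epsl minl.
have /andP[l0 le_l] := l_i.
have Bl : gt_B L i l = gt_B L i l.-1 + gt_b L i l.
  by rewrite /gt_B prednK // big_nat_recr.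
have b_gt0 : 0 < gt_b L i l.
  have [lt_l | ge_l] := ltnP 1 l; last first.
    have -> : gt_b L i l = gt_B L i l; last by rewrite epsl.
    by rewrite Bl [gt_B _ _ l.-1]/gt_B big_geq ?add0r //; lia.
  have : gt_B L i l.-1 < gt_eps L i.
    rewrite lt_neqAle (bigmax_ge (gt_B L i)) ?andbT; last by lia.
    apply/negP=> /(minl l.-1); rewrite mem_iota; lia.
  by rewrite -epsl Bl; lia.
have H1 := @gtp_interlace _ _ _ gtpL i l; have H2 := @gtp_interlace _ _ _ gtpL i l.-1.
have H3 := @gtp_interlace _ _ _ gtpL i.-1 l; have H4 := @gtp_interlace _ _ _ gtpL i.-1 l.-1.
have ent0 k : ent L k 0 = 0%N by [].
rewrite /gt_b in b_gt0; rewrite !prednK // in H3 H4.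
have [l1 | l1] := ltnP 1 l.
  by rewrite prednK // in H2; apply: gtp_upd => //; lia.
have E : l = 1%N by lia.
rewrite {}E /= !ent0 in b_gt0 H1 H3 *.
by apply: gtp_upd => //; lia.
Qed.

(* [insub] returns [None] on arrays that are not patterns; this does not happen
   when phi_i > 0, resp. eps_i > 0: see [gt_f_def] and [gt_e_def]. *)
Definition gt_f n la (i : nat) (L : gtp n la) : option (gtp n la) :=
  if 0 < gt_phi (val L) i then insub (gt_f_arr (val L) i) else None.

Definition gt_e n la (i : nat) (L : gtp n la) : option (gtp n la) :=
  if 0 < gt_eps (val L) i then insub (gt_e_arr (val L) i) else None.

Definition GTP (n : nat) (la : seq nat) : crystal_data n := {|
  carrier := gtp n la;
  wt  := fun L => gt_wt (val L) n;
  e_  := fun i L => gt_e i.+1 L;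
  f_  := fun i L => gt_f i.+1 L;
  eps := fun i L => Some (gt_eps (val L) i.+1);
  phi := fun i L => Some (gt_phi (val L) i.+1)
|}.

(** * Semistandard Young tableaux *)

Definition is_ssyt (n : nat) (la : seq nat) (T : seq (seq nat)) : bool :=
  [&& shape T == la,
      all (all (fun x => 1 <= x <= n)%N) T,
      all (sorted leq) T
    & all (fun r => all (fun c => ent T r c < ent T r.+1 c)%N
        (iota 1 (part la r.+1))) (iota 1 (size la))].

Definition ssyt (n : nat) (la : seq nat) : Type :=
  {T : seq (seq nat) | is_ssyt n la T}.

(* The boxes (r, c) of the diagram, by columns from right to left and from top
   to bottom in each column. *)
Definition reading (la : seq nat) : seq (nat * nat) :=
  [seq (r, c) | c <- rev (iota 1 (part la 1)),
                r <- [seq r <- iota 1 (size la) | (c <= part la r)%N]].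

Definition fe_word (la : seq nat) (T : seq (seq nat)) : seq nat :=
  [seq ent T b.1 b.2 | b <- reading la].

Definition far_east n la (T : ssyt n la) : seq nat := fe_word la (val T).

Definition fe_fill (la : seq nat) (w : seq nat) : seq (seq nat) :=
  [seq [seq nth 0%N w (index (r, c) (reading la)) | c <- iota 1 (part la r)]
     | r <- iota 1 (size la)].

(* The inverse of [far_east] on its image, and [None] outside of the image:
   see [far_east_invP]. *)
Definition far_east_inv n la (w : seq nat) : option (ssyt n la) :=
  if insub (fe_fill la w) is Some T then
    if far_east T == w then Some T else None
  else None.

Lemma ssyt_shape n la T : is_ssyt n la T -> shape T = la.
Proof. by case/and4P=> /eqP. Qed.

Lemma reading_mem la r c :
  (0 < r <= size la)%N -> (0 < c <= part la r)%N -> (c <= part la 1)%N ->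
  (r, c) \in reading la.
Proof.
move=> r_la c_r c_1; apply/allpairsPdep; exists c, r; split=> //.
  by rewrite mem_rev mem_iota; lia.
by rewrite mem_filter mem_iota; lia.
Qed.

Lemma far_eastK n la (T : ssyt n la) : is_part la ->
  fe_fill la (far_east T) = val T.
Proof.
case/andP=> la_sorted _; case: T => T /= ssytT; rewrite /far_east /=.
have shT := ssyt_shape ssytT.
have sizeT : size T = size la by rewrite -shT size_map.
have rowT r : (r < size la)%N -> size (nth [::] T r) = nth 0%N la r.
  by move=> lt_r; rewrite -shT nth_shape.
apply: (@eq_from_nth _ [::]) => [|r]; rewrite size_map size_iota ?sizeT // => lt_r.
rewrite (nth_map 0%N) ?size_iota // nth_iota // add1n /part /=.
apply: (@eq_from_nth _ 0%N) => [|c]; rewrite size_map size_iota ?rowT // => lt_c.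
rewrite (nth_map 0%N) ?size_iota // nth_iota // add1n /fe_word.
have rc : (r.+1, c.+1) \in reading la.
  apply: reading_mem; rewrite /part //=.
  have geq_trans : transitive geq by move=> a b d; rewrite /geq /=; lia.
  have sP := sorted_leq_nth geq_trans leqnn 0%N la_sorted.
  by apply: leq_trans lt_c (sP 0%N r _ _ _); rewrite ?inE //; lia.
by rewrite (nth_map (0, 0)%N) ?index_mem // nth_index.
Qed.

Lemma far_east_invP n la w (T : ssyt n la) : is_part la ->
  far_east_inv n la w = Some T <-> far_east T = w.
Proof.
move=> la_part; rewrite /far_east_inv; split=> [|<-].
  by case: insubP => [U _ _|//]; case: eqP => // <- [->].
by rewrite far_eastK // valK eqxx.
Qed.

Section Bracketing.
Variables (i : nat) (w : seq nat).

(* [s] is the increasing list of the positions (from 0) of [w] that are not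
   crossed out. *)
Definition bracket_step (s : seq nat) : seq nat :=
  let closers p := [seq q <- s | (p < q)%N && (nth 0%N w q == i.+1)] in
  let openers := [seq p <- s | (nth 0%N w p == i) && (closers p != [::])] in
  if openers is p0 :: ps then
    let p := last p0 ps in
    let q := head 0%N (closers p) in
    [seq r <- s | (r != p) && (r != q)]
  else s.

(* Every effective step crosses out two positions, and [bracket_step] is the
   identity once i, i+1 is no longer a subsequence. *)
Definition bracket : seq nat := iter (size w) bracket_step (iota 0 (size w)).

Definition unbracketed (x : nat) : seq nat :=
  [seq p <- bracket | nth 0%N w p == x].

Definition w_phi : nat := size (unbracketed i).
Definition w_eps : nat := size (unbracketed i.+1).

Definition w_f : seq nat := set_nth 0%N w (head 0%N (unbracketed i)) i.+1.
Definition w_e : seq nat := set_nth 0%N w (last 0%N (unbracketed i.+1)) i.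

End Bracketing.

Definition yt_wt n la (T : ssyt n la) : weight n :=
  \sum_(1 <= k < n.+1) evec n k *+ count_mem k (flatten (val T)).

Definition yt_f n la (i : nat) (T : ssyt n la) : option (ssyt n la) :=
  if (0 < w_phi i (far_east T))%N
  then far_east_inv n la (w_f i (far_east T)) else None.

Definition yt_e n la (i : nat) (T : ssyt n la) : option (ssyt n la) :=
  if (0 < w_eps i (far_east T))%N
  then far_east_inv n la (w_e i (far_east T)) else None.

Definition SSYT (n : nat) (la : seq nat) : crystal_data n := {|
  carrier := ssyt n la;
  wt  := fun T => yt_wt T;
  e_  := fun i T => yt_e i.+1 T;
  f_  := fun i T => yt_f i.+1 T;
  eps := fun i T => Some (w_eps i.+1 (far_east T))%:Z;
  phi := fun i T => Some (w_phi i.+1 (far_east T))%:Z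
|}.

(** * The bijection from patterns to tableaux *)

(* the box (r, c) belongs to the skew diagram lambda^(i) / lambda^(i-1) *)
Definition in_skew (L : seq (seq nat)) (i r c : nat) : bool :=
  (ent L i.-1 r < c <= ent L i r)%N.

Definition tab_arr (n : nat) (la : seq nat) (L : seq (seq nat)) :
    seq (seq nat) :=
  [seq [seq head 0%N [seq i <- iota 1 n | in_skew L i r c]
          | c <- iota 1 (part la r)] | r <- iota 1 (size la)].

Lemma tab_arrE n la L r c : is_gtp n la L -> (size la <= n)%N ->
    (0 < r <= size la)%N -> (0 < c <= part la r)%N ->
  let k := ent (tab_arr n la L) r c in
  [/\ (0 < k <= n)%N, in_skew L k r c
    & forall i, (i <= n)%N -> (c <= ent L i r)%N -> (k <= i)%N].
Proof.
move=> gtpL le_n; case: r => // r /= lt_r; case: c => // c /= lt_c.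
pose k := head 0%N [seq i <- iota 1 n | in_skew L i r.+1 c.+1].
rewrite (_ : ent _ _ _ = k); last first.
  rewrite /ent /arow /tab_arr {1}/part /= (nth_map 0%N) ?size_iota //.
  by rewrite nth_iota // add1n (nth_map 0%N) ?size_iota // nth_iota.
have least : exists i, (c.+1 <= ent L i r.+1)%N.
  by exists n; rewrite (gtp_top gtpL) //; lia.
have [m cm minm] := ex_minnP least.
have m_n : (m <= n)%N by apply: minm; rewrite (gtp_top gtpL) //; lia.
have m0 : (0 < m)%N by case: (m) cm => //; rewrite (gtp_ent0 gtpL).
have m_skew : in_skew L m r.+1 c.+1.
  rewrite /in_skew cm andbT ltnNge; apply/negP => /minm; lia.
have := @head_filter_iota (fun i => in_skew L i r.+1 c.+1) 1 n m.
have m_iota : m \in iota 1 n by rewrite mem_iota; lia.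
case/(_ m_iota m_skew); rewrite -/k mem_iota => k_n k_skew mink.
split=> [|//|i i_n /minm m_i]; first by lia.
by apply: leq_trans m_i; apply: mink.
Qed.

Lemma tab_arr_ssyt n la L :
  (size la <= n)%N -> is_gtp n la L -> is_ssyt n la (tab_arr n la L).
Proof.
move=> le_n gtpL; have TE := tab_arrE gtpL le_n.
have shT : shape (tab_arr n la L) = la.
  apply: (@eq_from_nth _ 0%N) => [|r]; first by rewrite !size_map size_iota.
  rewrite !size_map size_iota => lt_r; rewrite (nth_map [::]) ?size_map ?size_iota //.
  by rewrite (nth_map 0%N) ?size_iota // nth_iota // size_map size_iota.
have sizeT : size (tab_arr n la L) = size la by rewrite size_map size_iota.
have rowT r : (r < size la)%N -> size (nth [::] (tab_arr n la L) r) = nth 0%N la r.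
  by move=> lt_r; rewrite -[in RHS]shT nth_shape.
apply/and4P; split; first exact/eqP.
- apply/(all_nthP [::]) => r; rewrite sizeT => lt_r.
  apply/(all_nthP 0%N) => c; rewrite rowT // => lt_c.
  by have [] := TE r.+1 c.+1 lt_r lt_c.
- apply/(all_nthP [::]) => r; rewrite sizeT => lt_r.
  apply/(sortedP 0%N) => c; rewrite rowT // => lt_c.
  have [_ _ mink] := TE r.+1 c.+1 lt_r (ltnW lt_c).
  have [k_n /andP[_ le_k] _] := TE r.+1 c.+2 lt_r lt_c.
  by case/andP: k_n => _ k_n; apply: mink k_n (ltnW le_k).
apply/allP => r; rewrite mem_iota => r_la; apply/allP => c; rewrite mem_iota => c_la.
have lt_r : (r < size la)%N.
  by rewrite ltnNge; apply/negP => le_r; move: c_la; rewrite part_oversize //; lia.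
have part_r : (part la r.+1 <= part la r)%N.
  have := @gtp_interlace _ _ _ gtpL n.-1 r.
  rewrite prednK; last by lia.
  by rewrite !(gtp_top gtpL); lia.
have [_ _ mink] := TE r c ltac:(lia) ltac:(lia).
have [k_n /andP[_ le_k] _] := TE r.+1 c lt_r ltac:(lia).
set k := ent _ r.+1 c in k_n le_k *.
have r_k : (r < k)%N.
  rewrite ltnNge; apply/negP => k_r; move: le_k.
  by rewrite (gtp_ent0 gtpL) //; lia.
have := @gtp_interlace _ _ _ gtpL k.-1 r; rewrite prednK; last by lia.
move=> H; have := mink k.-1; lia.
Qed.

(* The bijection Lambda |-> T(Lambda); it is extended by 0 |-> 0 with [omap]. *)
Definition tab n la (la_n : (size la <= n)%N) (L : gtp n la) : ssyt n la :=
  exist _ (tab_arr n la (val L)) (tab_arr_ssyt la_n (valP L)).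

(* Main.v *)
Require Import Defs.
From mathcomp Require Import all_boot all_order all_algebra.
From mathcomp Require Import zify.

(** The operators on both sides are governed by the same maxima, so the whole
    theorem reduces to comparing two height functions.

    Words.  For a word w let H(x) be the number of letters i minus the number
    of letters i+1 in the suffix of w that starts at position x.  Crossing out
    a matched pair i ... i+1 changes H only between the two letters, where it
    rises to the value that H has just before the i and just after the i+1.
    Hence neither the maximum of H nor the first or last place where it is
    reached ever changes, and they can be read off at the end of the bracketing,
    when the letters i+1 and i that remain form the word (i+1)^eps i^phi.  So
    phi = max H, the letter that f changes sits at the last place where the
    maximum is reached ([w_phi_last_peak]), and the letter that e changes sits
    just before the first such place ([w_phi_first_peak]).  A change by f turns
    the last peak p into a first peak p+1, and conversely for e; thus e and f
    are mutually inverse on words ([w_fK], [w_eK]).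

    Patterns.  Since b_(j+1) = - a_j, one has B_j = A_j - A_0 ([gt_BE]).  So
    e and f on patterns are also governed by one function, namely A: f acts at
    its last maximum and e at its first one.  Lowering the entry l of row i
    subtracts 2 from A_j for j < l and 1 from A_l, which turns a last maximum
    into a first one.  Moreover A_0 = phi - eps is the value of the coroot on the weight.
    The crystal axioms for patterns follow ([GTP_crystal]).

    Comparison.  In the tableau of a pattern, the entry in row r and column c is
    at most k exactly when c is at most the entry r of row k of the pattern
    ([tab_leE]).  Counting boxes with this rule, the height of the reading word
    at a box of row r with letter i equals A_r minus a nonnegative defect, and
    the defect vanishes at the last i of the row ([tab_height]).  As H does not
    drop when moving right to the next letter i, a positive maximum of H is the
    maximum of the A_r, and its last place is the last i in row l, where l is
    the last maximum of A.  Turning this letter into i+1 is what lowering the entry l of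
    row i of the pattern does to the tableau ([fe_word_lowering]).  So the
    bijection commutes with f and preserves phi and the weight, hence also eps,
    and it carries the crystal axioms from patterns to tableaux, where the
    inverse relation of e and f comes from words. *)

Set Implicit Arguments.
Unset Strict Implicit.
Unset Printing Implicit Defensive.

Import Order.TTheory GRing.Theory Num.Theory.
Local Open Scope ring_scope.

(** * Peaks of integer functions *)

Definition last_peak (h : nat -> int) (P : nat) : Prop :=
  (forall x, h x <= h P) /\ (forall x, (P < x)%N -> h x < h P).

Definition first_peak (h : nat -> int) (P : nat) : Prop :=
  (forall x, h x <= h P) /\ (forall x, (x < P)%N -> h x < h P).

Lemma ex_max (h : nat -> int) N : (forall x, (N <= x)%N -> h x = 0) ->
  exists2 y, (y <= N)%N & forall x, h x <= h y.
Proof.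
move=> h0; pose F := (fun x : 'I_N.+1 => h x).
case: (@arg_maxP _ _ _ (ord0 : 'I_N.+1) xpredT F isT) => y _ ymax.
exists y; first by have := ltn_ord y.
move=> x; have [ltx|lex] := ltnP x N.+1; first exact: (ymax (Ordinal ltx) isT).
by have := ymax ord_max isT; rewrite /F /= (h0 x (ltnW lex)) h0.
Qed.

(** If all values are nonpositive, the maximum 0 is reached at every x >= N, so it
    has no last place. *)
Lemma ex_last_peak (h : nat -> int) N : (forall x, (N <= x)%N -> h x = 0) ->
  (forall x, h x <= 0) \/ exists P, last_peak h P.
Proof.
move=> h0; have [y leN ymax] := ex_max h0.
have [le0|gt0] := lerP (h y) 0; first by left=> x; apply: le_trans (ymax x) le0.
have bound x : h x == h y -> (x <= N)%N.
  by move=> /eqP xy; case: (leqP x N) => // /ltnW /h0; lia.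
have exP : exists x, h x == h y by exists y.
case: (ex_maxnP exP bound) => P /eqP PE Pmax.
right; exists P; split=> x; rewrite PE // => Px.
rewrite lt_neqAle ymax andbT; apply/negP => /Pmax; lia.
Qed.

Lemma ex_first_peak (h : nat -> int) N : (forall x, (N <= x)%N -> h x = 0) ->
  exists P, first_peak h P.
Proof.
move=> h0; have [y leN ymax] := ex_max h0.
have exP : exists x, h x == h y by exists y.
case: (ex_minnP exP) => P /eqP PE Pmin.
exists P; split=> x; rewrite PE // => Px.
rewrite lt_neqAle ymax andbT; apply/negP => /Pmin; lia.
Qed.

Lemma sorted_ltn_last s d x : sorted ltn s -> x \in s -> (x <= last d s)%N.
Proof.
elim/last_ind: s => // s y _; rewrite last_rcons -cats1 sorted_pairwise; last exact: ltn_trans.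
rewrite pairwise_cat mem_cat inE allrel1r => /and3P[/allP sy _ _].
by case/orP=> [/sy /ltnW|/eqP->].
Qed.

Lemma sorted_ltn_head s d x : sorted ltn s -> x \in s -> (head d s <= x)%N.
Proof.
case: s => //= y s /(order_path_min ltn_trans)/allP ys.
by rewrite inE => /predU1P[->//|/ys /ltnW].
Qed.

(** * Bracketing and the height of a word *)

Section Height.
Variables (i : nat) (w : seq nat).

(** The contribution of a letter to the height: an opening i counts +1, a closing
    i+1 counts -1. *)
Definition bsign (a : nat) : int := (a == i)%:Z - (a == i.+1)%:Z.

(** The list s holds the positions that are not yet crossed out, so that one
    function serves for all stages of the bracketing. *)
Definition height (s : seq nat) (x : nat) : int :=
  \sum_(q <- s | (x <= q)%N) bsign (nth 0%N w q).

Lemma height_split s a b : (a <= b)%N ->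
  height s a
  = \sum_(q <- s | (a <= q < b)%N) bsign (nth 0%N w q) + height s b.
Proof.
move=> ab; rewrite /height (bigID (fun q => (q < b)%N)) /=; congr (_ + _).
by apply: eq_bigl => q; lia.
Qed.

Lemma heightS s x : uniq s ->
  height s x = (if x \in s then bsign (nth 0%N w x) else 0) + height s x.+1.
Proof.
move=> us; rewrite (@height_split s x x.+1) //; congr (_ + _).
rewrite (eq_bigl (pred1 x)) => [|q]; last by rewrite /=; lia.
case: ifP => xs; first by rewrite -big_filter filter_pred1_uniq ?big_seq1.
rewrite big_seq_cond big1 // => q /andP[qs /eqP qx]; by rewrite qx xs in qs.
Qed.

(** The opener p is chosen rightmost and the closer q leftmost after p, which
    leaves no i and no i+1 between them. *)
Lemma bracket_stepP s : sorted ltn s ->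
  let s' := bracket_step i w s in
  (s' = s /\
     forall p q, p \in s -> q \in s -> (p < q)%N ->
       nth 0%N w p = i -> nth 0%N w q != i.+1) \/
  exists p q,
    [/\ p \in s, q \in s, (p < q)%N, nth 0%N w p = i & nth 0%N w q = i.+1] /\
    (forall r, r \in s -> (p < r < q)%N -> bsign (nth 0%N w r) = 0) /\
    s' = [seq r <- s | (r != p) && (r != q)].
Proof.
move=> ss s'.
(* candidates for the closer of p, and candidates for the opener *)
pose cl p := [seq q <- s | (p < q)%N && (nth 0%N w q == i.+1)].
pose op := [seq p <- s | (nth 0%N w p == i) && (cl p != [::])].
have {s'}-> : s' = if op is p0 :: ps then let p := last p0 ps in
    [seq r <- s | (r != p) && (r != head 0%N (cl p))] else s by [].
have clP p q : (q \in cl p) = [&& (p < q)%N, nth 0%N w q == i.+1 & q \in s].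
  by rewrite mem_filter andbA.
have scl p : sorted ltn (cl p) by apply: (sorted_filter ltn_trans).
have opP p : (p \in op) = [&& nth 0%N w p == i, cl p != [::] & p \in s].
  by rewrite mem_filter andbA.
have sop : sorted ltn op by apply: (sorted_filter ltn_trans).
case E: op => [|p0 ps]; [left|right].
  split=> // p q ps qs pq pi; apply/negP => qi.
  have : p \in op.
    by rewrite opP pi eqxx ps andbT /=; apply/eqP => cl0; have := clP p q; rewrite cl0 pq qi qs.
  by rewrite E.
set p := last p0 ps; set q := head 0%N (cl p).
have pop : p \in op by rewrite E mem_last.
have := pop; rewrite opP => /and3P[/eqP pi cl0 pins].
have qcl : q \in cl p by rewrite /q; case: (cl p) cl0 => //= *; rewrite mem_head.
have := qcl; rewrite clP => /and3P[pq /eqP qi qs].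
exists p, q; split; [by split|split=> //] => r rs /andP[pr rq].
rewrite /bsign; case: eqP => [ri|_].
  have /(sorted_ltn_last 0%N sop) : r \in op.
    by rewrite opP ri eqxx rs andbT /=; apply/eqP => c0; have := clP r q; rewrite c0 rq qi eqxx qs.
  by rewrite E /= -/p; lia.
case: eqP => // ri1.
have /(sorted_ltn_head 0%N (scl p)) : r \in cl p by rewrite clP pr ri1 eqxx.
by rewrite -/q; lia.
Qed.

Lemma bracket_step_sorted s : sorted ltn s -> sorted ltn (bracket_step i w s).
Proof.
move=> ss; case: (bracket_stepP ss) => [[-> //]|[p [q [_ [_ ->]]]]].
exact: (sorted_filter ltn_trans).
Qed.

(** Removing an i at p and an i+1 at q changes only the suffixes that contain q
    but not p.  As nothing strictly between p and q counts, the height there was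
    one less than at p, or equivalently than just after q, and it is now equal
    to both.  The comparison with p is what keeps first maxima, and the one with
    q+1 what keeps last maxima. *)
Lemma height_step s : sorted ltn s ->
  let h := height s in let h' := height (bracket_step i w s) in
  bracket_step i w s = s \/
  exists p q, [/\ (p < q)%N,
    forall x, ~~ (p < x <= q)%N -> h' x = h x &
    forall x, (p < x <= q)%N -> [/\ h' x = h p, h' x = h q.+1 & h x < h' x]].
Proof.
move=> ss /=; case: (bracket_stepP ss) => [[-> _]|[p [q H]]]; [by left|right].
case: H => [[ps qs pq pi qi] [mid ->]]; exists p, q.
have us : uniq s := sorted_uniq ltn_trans ltnn ss.
have i1 : (i == i.+1) = false by lia.
have bp : bsign (nth 0%N w p) = 1 by rewrite /bsign pi eqxx i1.
have bq : bsign (nth 0%N w q) = -1 by rewrite /bsign qi eqxx eq_sym i1.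
set s' := filter _ s.
have hx x : height s' x = height s x - ((x <= p)%N : nat)%:Z + ((x <= q)%N : nat)%:Z.
  pose F r := if (x <= r)%N then bsign (nth 0%N w r) else 0.
  have -> : height s' x = \sum_(r <- s | (r != p) && (r != q)) F r.
    by rewrite /height /s' big_filter_cond big_mkcondr.
  have -> : height s x = F p + (F q + \sum_(r <- s | (r != p) && (r != q)) F r).
    rewrite /height big_mkcond (bigD1_seq p) //=; congr (_ + _).
    rewrite -big_filter (bigD1_seq q) ?filter_uniq ?mem_filter ?qs ?gtn_eqF //=.
    by rewrite big_filter_cond.
  rewrite /F bp bq.
  by case: (x <= p)%N; case: (x <= q)%N; lia.
(* the only position of [a, b) that counts is the end r of the pair *)
have sum1 a b r : (r \in s) -> (a <= r < b)%N -> (p <= a)%N -> (b <= q.+1)%N ->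
    (r == p) || (r == q) -> ((p < a) || (b <= q))%N ->
    \sum_(t <- s | (a <= t < b)%N) bsign (nth 0%N w t) = bsign (nth 0%N w r).
  move=> rs rab pa bq' rpq abpq; rewrite big_mkcond (bigD1_seq r) //= rab.
  rewrite big_seq_cond big1 ?addr0 // => t /andP[ts tr]; case: ifP => // tab.
  by apply: mid => //; lia.
split=> // x x_pq; first by rewrite hx; lia.
have h1 : height s p = 1 + height s x.
  by rewrite (@height_split s p x) ?(sum1 p x p) ?bp //; lia.
have h2 : height s x = -1 + height s q.+1.
  by rewrite (@height_split s x q.+1) ?(sum1 x q.+1 q) ?bq //; lia.
by rewrite hx; split; lia.
Qed.

(** An invariant of height functions under the move of [height_step] passes from
    the whole word to the result of the bracketing. *)
Lemma bracket_ind (Q : (nat -> int) -> Prop) :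
    (forall h h' p q, (p < q)%N ->
       (forall x, ~~ (p < x <= q)%N -> h' x = h x) ->
       (forall x, (p < x <= q)%N -> [/\ h' x = h p, h' x = h q.+1 & h x < h' x]) ->
     Q h -> Q h') ->
  Q (height (iota 0 (size w))) -> Q (height (bracket i w)).
Proof.
move=> Qstep Q0; rewrite /bracket; set m := (X in iter X).
suff [] : sorted ltn (iter m (bracket_step i w) (iota 0 (size w))) /\
          Q (height (iter m (bracket_step i w) (iota 0 (size w)))) by [].
elim: m => [|m [sm Qm]] /=; first by split=> //; apply: iota_ltn_sorted.
split; first exact: bracket_step_sorted.
have [-> //|[p [q [pq out inn]]]] := height_step sm.
exact: Qstep pq out inn Qm.
Qed.

(** Every step that does something shortens the list, so size w steps suffice to
    reach a list on which a step changes nothing, and there no i precedes an i+1. *)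
Lemma bracket_final :
  sorted ltn (bracket i w) /\
  forall p q, p \in bracket i w -> q \in bracket i w -> (p < q)%N ->
       nth 0%N w p = i -> nth 0%N w q != i.+1.
Proof.
set s := iter (size w) (bracket_step i w) (iota 0 (size w)).
have [ss sfix] : sorted ltn s /\ bracket_step i w s = s.
  (* either a fixed point was reached, or each of the m steps removed a position *)
  suff : forall m, let t := iter m (bracket_step i w) (iota 0 (size w)) in
      sorted ltn t /\ (bracket_step i w t = t \/ (size t <= size w - m)%N).
    case/(_ (size w)) => ss [//|].
    by rewrite -/s subnn leqn0 size_eq0 => /eqP s0; split=> //; rewrite s0.
  elim=> [|m [sm IH]] /=.
    split; first exact: iota_ltn_sorted.
    by right; rewrite size_iota subn0.
  split; first exact: bracket_step_sorted.
  case: IH => [E|le_m]; first by left; rewrite !E.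
  set t := iter _ _ _ in sm le_m *.
  have [[E _]|[p [q [[pt _ _ _ _] [_ E]]]]] := bracket_stepP sm; [left|right].
    by rewrite !E.
  have : (size (bracket_step i w t) < size t)%N; last by lia.
  rewrite E size_filter -[X in (_ < X)%N](count_predC (fun r => (r != p) && (r != q))).
  rewrite -[X in (X < _)%N]addn0 ltn_add2l -has_count.
  by apply/hasP; exists p => //=; rewrite eqxx.
split=> //; have [[]//|[p [q [[ps _ _ _ _] [_ E]]]]] := bracket_stepP ss.
by move: ps; rewrite -sfix E mem_filter eqxx.
Qed.
End Height.

Definition word_height (i : nat) (w : seq nat) : nat -> int :=
  height i w (iota 0 (size w)).

(** * Crystal operators on words through peaks of the height *)

Section WordPeaks.
Variables (i : nat) (w : seq nat).
Let s := bracket i w.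
Let H := word_height i w.
Let w_ := nth 0%N w.

(** A last peak P cannot lie inside the pair (p, q], where the height was below
    the height at p; and a position x of (p, q] after P takes the height of q+1,
    which also comes after P. *)
Lemma bracket_last_peak P : last_peak H P ->
  last_peak (height i w s) P /\ height i w s P = H P.
Proof.
move=> peakP; apply: (bracket_ind (Q := fun h => last_peak h P /\ h P = H P)) => //.
move=> h h' p q pq out inn [[hP hgt] hHP].
have Pout : ~~ (p < P <= q)%N.
  by apply/negP => /inn[h1 _ h3]; have := hP p; lia.
rewrite /last_peak (out _ Pout); split=> //; split=> x.
  by have [/inn[-> _ _]|/out ->] := boolP (p < x <= q)%N.
move=> Px; have [xin|/out->] := boolP (p < x <= q)%N; last exact: hgt.
by have [_ -> _] := inn x xin; apply: hgt; lia.
Qed.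

(** A position x of (p, q] before P takes the height of p, which also comes
    before P. *)
Lemma bracket_first_peak P : first_peak H P ->
  first_peak (height i w s) P /\ height i w s P = H P.
Proof.
move=> peakP; apply: (bracket_ind (Q := fun h => first_peak h P /\ h P = H P)) => //.
move=> h h' p q pq out inn [[hP hlt] hHP].
have Pout : ~~ (p < P <= q)%N.
  by apply/negP => /inn[h1 _ h3]; have := hP p; lia.
rewrite /first_peak (out _ Pout); split=> //; split=> x.
  by have [/inn[-> _ _]|/out ->] := boolP (p < x <= q)%N.
move=> Px; have [xin|/out->] := boolP (p < x <= q)%N; last exact: hlt.
by have [-> _ _] := inn x xin; apply: hlt; lia.
Qed.

Lemma bracket_height_le0 :
  (forall x, H x <= 0) -> forall x, height i w s x <= 0.
Proof.
apply: (bracket_ind (Q := fun h => forall x, h x <= 0)).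
move=> h h' p q pq out inn h0 x.
by have [/inn[-> _ _]|/out ->] := boolP (p < x <= q)%N.
Qed.

Lemma bracket_height0 : height i w s 0 = H 0.
Proof.
by apply: (bracket_ind (Q := fun h => h 0%N = H 0)) => // h h' p q pq ->.
Qed.

Lemma size_unbracketed x : size (unbracketed i w x) = count (fun q => w_ q == x) s.
Proof. by rewrite size_filter. Qed.

(** Each step crosses out one i and one i+1, so the total height never changes. *)
Lemma w_phi_eps : (w_phi i w)%:Z - (w_eps i w)%:Z = H 0.
Proof.
rewrite -bracket_height0 /w_phi /w_eps !size_unbracketed.
rewrite /height; elim: s => [|q t IH]; rewrite /= ?big_nil // big_cons -IH.
by rewrite leq0n /bsign /w_ !PoszD; lia.
Qed.

Let us_ : uniq s.
Proof. by case: (bracket_final i w) => /(sorted_uniq ltn_trans ltnn). Qed.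

Lemma height_bracketS x : height i w s x =
  (if x \in s then bsign i (w_ x) else 0) + height i w s x.+1.
Proof. exact: heightS. Qed.

Lemma height_after x :
    (forall q, q \in s -> (x <= q)%N -> w_ q != i.+1) ->
  height i w s x = (count (fun q => (x <= q)%N && (w_ q == i)) s)%:Z.
Proof.
rewrite /height; elim: s => [|q t IH] h; first by rewrite big_nil.
rewrite big_cons /= IH => [|r rt]; last by apply: h; rewrite inE rt orbT.
case: (leqP x q) => //= xq; have := h q; rewrite inE eqxx xq => /(_ isT isT).
by rewrite /bsign /w_ PoszD => /negPf->; lia.
Qed.

Lemma count_i_after x :
    (forall q, q \in s -> w_ q = i -> (x <= q)%N) ->
    (forall q, q \in s -> (x <= q)%N -> w_ q != i.+1) ->
  (w_phi i w)%:Z = height i w s x.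
Proof.
move=> h1 h2; rewrite height_after // /w_phi size_unbracketed; congr Posz.
apply: eq_in_count => q qs /=; case: eqP => [/h1->//|_]; by rewrite andbF.
Qed.

Lemma no_closer_after x : x \in s -> w_ x = i ->
  forall q, q \in s -> (x <= q)%N -> w_ q != i.+1.
Proof.
move=> xs xi q qs; rewrite leq_eqVlt => /predU1P[<-|xq].
  by rewrite xi; lia.
by have [_] := bracket_final i w; apply; first exact: xs.
Qed.

Lemma w_phi_le0 : (forall x, H x <= 0) -> w_phi i w = 0%N.
Proof.
move/bracket_height_le0 => h0; apply/eqP; rewrite /w_phi size_unbracketed.
rewrite -leqn0 leqNgt -has_count; apply/hasPn => x xs; apply/eqP => xi.
have := h0 x; rewrite height_after; last exact: no_closer_after.
suff : has (fun q => (x <= q)%N && (w_ q == i)) s by rewrite has_count; lia.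
by apply/hasP; exists x; rewrite //= leqnn xi eqxx.
Qed.

(** After the bracketing no i+1 follows an i, so from the first remaining i on the
    height is the number of remaining letters i from there on, and it is maximal
    for the last time at that first i. *)
Lemma w_phi_last_peak P : last_peak H P ->
  [/\ (w_phi i w)%:Z = H P, w_ P = i & head 0%N (unbracketed i w i) = P].
Proof.
case/bracket_last_peak => -[hmax hlt] hP.
have [Ps Pi] : P \in s /\ w_ P = i.
  have := hlt P.+1 (ltnSn P); rewrite [X in _ < X]height_bracketS.
  case: ifP; last by lia.
  rewrite /bsign; case: eqP => [-> _ _|_]; first by split.
  by case: eqP => _ _; lia.
have first x : x \in s -> w_ x = i -> (P <= x)%N.
  move=> xs xi; rewrite leqNgt; apply/negP => xP.
  have := hmax x; rewrite height_after; last exact: no_closer_after.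
  rewrite height_after; last exact: no_closer_after.
  rewrite (_ : count (fun q => (x <= q)%N && _) s
     = (count (fun q => (P <= q)%N && (w_ q == i)) s +
        count (fun q => (x <= q < P)%N && (w_ q == i)) s)%N).
    suff : has (fun q => (x <= q < P)%N && (w_ q == i)) s by rewrite has_count; lia.
    by apply/hasP; exists x; rewrite //= leqnn xi eqxx xP.
  elim: (s) => //= q t ->; case: (w_ q == i); rewrite ?andbF ?andbT //; lia.
split=> //; first by rewrite -hP; apply: count_i_after first (no_closer_after Ps Pi).
have Pu : P \in unbracketed i w i by rewrite mem_filter -/w_ Pi eqxx.
have su : sorted ltn (unbracketed i w i).
  by apply: (sorted_filter ltn_trans); case: (bracket_final i w).
apply/eqP; rewrite eqn_leq (sorted_ltn_head 0%N su Pu) /=.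
have : head 0%N (unbracketed i w i) \in unbracketed i w i.
  by case: (unbracketed i w i) Pu => //= *; apply: mem_head.
by rewrite mem_filter => /andP[/eqP hi hs]; apply: first.
Qed.

(** After the bracketing the height increases along the remaining letters i+1 and
    reaches its maximum right after the last of them; hence the shift by one
    from the peak P to the letter at P.-1. *)
Lemma w_phi_first_peak P : first_peak H P ->
  (w_phi i w)%:Z = H P /\
  ((0 < P)%N -> w_ P.-1 = i.+1 /\ last 0%N (unbracketed i w i.+1) = P.-1).
Proof.
case/bracket_first_peak => -[hmax hlt] hP.
have noclose q : q \in s -> (P <= q)%N -> w_ q != i.+1.
  move=> qs Pq; apply/negP => /eqP qi.
  have noopen : forall r, r \in s -> (P <= r < q.+1)%N -> w_ r != i.
    move=> r rs rP; apply/eqP => ri.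
    by have := no_closer_after rs ri qs; rewrite qi eqxx => H0; have := H0 ltac:(lia).
  have := hmax q.+1; rewrite (height_split i w s (leqW Pq)) lerDr leNgt => /negP; apply.
  rewrite (big_rem q) //= Pq ltnSn {1}/bsign -/w_ qi eqxx.
  rewrite (_ : (i.+1 == i) = false); last by lia.
  apply: (@lt_le_trans _ _ (0 + 0)) => //; apply: ltr_leD => //.
  rewrite big_seq_cond; apply: sumr_le0 => r /andP[/mem_rem rs rP].
  by rewrite /bsign (negPf (noopen r rs rP)); case: eqP.
have pred : (0 < P)%N -> P.-1 \in s /\ w_ P.-1 = i.+1.
  move=> P0; have := hlt P.-1; rewrite [X in X < _]height_bracketS prednK //.
  move=> /(_ (leqnn P)); case: ifP; last by lia.
  rewrite /bsign; have [->|_] := w_ P.-1 =P i.+1; first by split.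
  by case: eqP; lia.
split.
  rewrite -hP; apply: count_i_after => // q qs qi.
  rewrite leqNgt; apply/negP => qP; have [] := pred (leq_ltn_trans (leq0n q) qP).
  by move=> ps pi; have := no_closer_after qs qi ps; rewrite pi eqxx => H0; have := H0 ltac:(lia).
move=> P0; have [ps pi] := pred P0; split=> //.
have pu : P.-1 \in unbracketed i w i.+1 by rewrite mem_filter -/w_ pi eqxx.
have su : sorted ltn (unbracketed i w i.+1).
  by apply: (sorted_filter ltn_trans); case: (bracket_final i w).
apply/eqP; rewrite eqn_leq (sorted_ltn_last 0%N su pu) andbT.
have : last 0%N (unbracketed i w i.+1) \in unbracketed i w i.+1.
  by case: (unbracketed i w i.+1) pu => //= *; apply: mem_last.
rewrite mem_filter => /andP[/eqP hi hs]; rewrite -ltnS prednK // ltnNge.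
by apply/negP => /(noclose _ hs); rewrite /w_ hi eqxx.
Qed.

Lemma word_heightS x : H x = (if (x < size w)%N then bsign i (w_ x) else 0) + H x.+1.
Proof. by rewrite /H /word_height heightS ?iota_uniq // mem_iota. Qed.

Lemma word_height_oversize x : (size w <= x)%N -> H x = 0.
Proof.
move=> lex; rewrite /H /word_height /height big_seq_cond big1 // => q.
by rewrite mem_iota; lia.
Qed.

Lemma ex_word_last_peak : (0 < w_phi i w)%N -> exists P, last_peak H P.
Proof.
by move=> phi0; have [/w_phi_le0|//] := ex_last_peak word_height_oversize; lia.
Qed.

End WordPeaks.

Lemma last_peak_size i w P : last_peak (word_height i w) P -> (P < size w)%N.
Proof.
case=> _ /(_ P.+1 (ltnSn P)); rewrite ltnNge; apply: contraPN => le_P.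
by rewrite !word_height_oversize ?ltxx //; lia.
Qed.

Lemma word_height0 i w :
  word_height i w 0 = (count_mem i w)%:Z - (count_mem i.+1 w)%:Z.
Proof.
have -> : word_height i w 0 = \sum_(a <- w) bsign i a.
  by rewrite (big_nth 0%N) /index_iota subn0.
elim: w => [|a w IH]; first by rewrite big_nil.
by rewrite big_cons IH /bsign /= !PoszD; lia.
Qed.

Lemma word_height_flip i w p y : (p < size w)%N ->
  forall x, word_height i (set_nth 0%N w p y) x
    = word_height i w x + if (x <= p)%N then bsign i y - bsign i (nth 0%N w p) else 0.
Proof.
move=> ltp x; set w' := set_nth _ _ _ _.
have sw : size w' = size w by rewrite size_set_nth; apply/maxn_idPr.
rewrite /word_height sw /height.
rewrite (eq_bigr (fun q => bsign i (nth 0%N w q) +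
    if q == p then bsign i y - bsign i (nth 0%N w p) else 0)) => [|q _].
  rewrite big_split /=; congr (_ + _); rewrite -big_mkcondr.
  case: ifP => xp.
    rewrite (eq_bigl (pred1 p)) => [|q]; last by rewrite /=; lia.
    by rewrite -big_filter filter_pred1_uniq ?iota_uniq ?big_seq1 // mem_iota.
  by rewrite big1 // => q; lia.
by rewrite nth_set_nth /=; case: eqP => [->|_]; lia.
Qed.

(** Turning the i at the last peak P into i+1 lowers the height by 2 up to P, and
    leaves it unchanged after P, where it was at most the height of P minus 1.
    This value is reached at P+1, which has become the first peak, so e changes
    the same letter back. *)
Lemma w_fK i w : (0 < w_phi i w)%N ->
  (0 < w_eps i (w_f i w))%N /\ w_e i (w_f i w) = w.
Proof.
move=> /ex_word_last_peak[P peakP]; have ltP := last_peak_size peakP.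
have [phiE wP headP] := w_phi_last_peak peakP.
have H' := word_height_flip i i.+1 ltP.
have i1 : (i.+1 == i) = false by lia.
have fE : w_f i w = set_nth 0%N w P i.+1 by rewrite /w_f headP.
rewrite -fE wP /bsign !eqxx i1 [i == _]eq_sym i1 in H'.
have HS := word_heightS i w P; rewrite ltP wP /bsign eqxx [i == _]eq_sym i1 in HS.
have [Pmax Plt] := peakP.
have peak' : first_peak (word_height i (w_f i w)) P.+1.
  split=> x; rewrite !H' ltnn.
    case: ifP => xP; first by have := Pmax x; lia.
    by have := Plt x; lia.
  by move=> xP; rewrite ifT //; have := Pmax x; lia.
have [phi' /(_ isT)[_ /= last']] := w_phi_first_peak peak'.
split; last first.
  rewrite /w_e last' fE; apply: (@eq_from_nth _ 0%N).
    by rewrite !size_set_nth; lia.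
  by move=> k _; rewrite !nth_set_nth /= !nth_set_nth /=; case: eqP => // ->.
have := w_phi_eps i (w_f i w); rewrite phi' !H' ltnn /=.
by have := Pmax 0%N; lia.
Qed.

(** Mirror image of [w_fK]: the first peak is P+1, and raising the height by 2 up
    to P makes P the last peak. *)
Lemma w_eK i w : (0 < w_eps i w)%N ->
  (0 < w_phi i (w_e i w))%N /\ w_f i (w_e i w) = w.
Proof.
move=> eps0; have [Q peakQ] := ex_first_peak (@word_height_oversize i w).
have [phiE lastQ] := w_phi_first_peak peakQ.
have Q0 : (0 < Q)%N.
  by have := w_phi_eps i w; rewrite phiE; case: (Q) => //; lia.
have {lastQ}[wQ lastQ] := lastQ Q0; case: Q Q0 => // P _ in peakQ phiE wQ lastQ *.
rewrite /= in wQ lastQ.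
(* the default letter 0 beyond the word is not i+1 *)
have ltP : (P < size w)%N.
  by rewrite ltnNge; apply/negP => le; rewrite nth_default in wQ.
have H' := word_height_flip i i ltP.
have i1 : (i.+1 == i) = false by lia.
have eE : w_e i w = set_nth 0%N w P i by rewrite /w_e lastQ.
rewrite -eE wQ /bsign !eqxx i1 [i == _]eq_sym i1 in H'.
have HS := word_heightS i w P; rewrite ltP wQ /bsign eqxx i1 in HS.
have [Qmax Qlt] := peakQ.
have peak' : last_peak (word_height i (w_e i w)) P.
  split=> x; rewrite !H' leqnn.
    case: ifP => xP; first by have := Qlt x; lia.
    by have := Qmax x; lia.
  by move=> xP; rewrite ifF; [have := Qmax x; lia | lia].
have [phi' _ head'] := w_phi_last_peak peak'.
split; last first.
  rewrite /w_f head' eE; apply: (@eq_from_nth _ 0%N).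
    by rewrite !size_set_nth; lia.
  by move=> k _; rewrite !nth_set_nth /= !nth_set_nth /=; case: eqP => // ->.
by rewrite H' leqnn in phi'; lia.
Qed.

(** * Sums over intervals, and equality of patterns *)

Lemma sum_pick (V : nmodType) (F : nat -> V) m n : (0 < m <= n)%N ->
  \sum_(1 <= k < n.+1) (if k == m then F k else 0) = F m.
Proof.
move=> m_n; rewrite (bigD1_seq m) ?iota_uniq ?mem_index_iota //= eqxx.
by rewrite big1 ?addr0 // => k /negPf->.
Qed.

Lemma sum_delta (a b l : nat) :
  \sum_(a <= k < b) (k == l : nat)%:Z = (a <= l < b)%N%:Z :> int.
Proof.
have [lab|nlab] := boolP (a <= l < b)%N.
  rewrite (bigD1_seq l) ?iota_uniq ?mem_index_iota //= eqxx big1 ?addr0 //.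
  by move=> k /negPf->.
rewrite big_seq_cond big1 // => k; rewrite mem_index_iota andbT => kab.
by case: eqP => // kl; rewrite -kl kab in nlab.
Qed.

Lemma ent0 L i : ent L i 0 = 0%N. Proof. by []. Qed.

Lemma gtp_ext n la L L' : is_gtp n la L -> is_gtp n la L' ->
  (forall i j, (0 < j <= i)%N -> (i <= n)%N -> ent L i j = ent L' i j) -> L = L'.
Proof.
move=> gL gL' LL'; apply: (@eq_from_nth _ [::]); rewrite (gtp_size gL) ?(gtp_size gL') // => i lt_i.
have [s1 s2] : size (nth [::] L i) = i.+1 /\ size (nth [::] L' i) = i.+1.
  by have := gtp_size_row gL (i := i.+1); have := gtp_size_row gL' (i := i.+1); split; auto.
apply: (@eq_from_nth _ 0%N); rewrite s1 ?s2 // => j lt_j.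
exact: (LL' i.+1 j.+1).
Qed.

(** * The crystal operators on patterns *)

Section RowOperators.
Variables (n : nat) (la : seq nat) (i : nat).
Hypothesis i_n : (0 < i < n)%N.

Lemma gt_AS L j : (j <= i)%N -> gt_A L i j = gt_a L i j + gt_A L i j.+1.
Proof. by move=> ji; rewrite /gt_A big_ltn. Qed.

Lemma gt_A_end L : gt_A L i i.+1 = 0.
Proof. by rewrite /gt_A big_geq. Qed.

(** The terms satisfy b_(j+1) = - a_j, so the partial sums B_j and the tail sums
    A_j differ by the constant A_0.  This lets the single function A govern both
    operators. *)
Lemma gt_BE L j : (j <= i.+1)%N -> gt_B L i j = gt_A L i j - gt_A L i 0.
Proof.
elim: j => [|j IH] ji; first by rewrite subrr /gt_B big_geq.
rewrite /gt_B big_nat_recr //= -/(gt_B L i j) IH ?(ltnW ji) //.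
have := @gt_AS L j ji; rewrite /gt_b /gt_a /=; lia.
Qed.

Lemma gt_phi_ge L j : (0 < j <= i)%N -> gt_A L i j <= gt_phi L i.
Proof. exact: bigmax_ge. Qed.

Lemma gt_epsE L : gt_eps L i = gt_phi L i - gt_A L i 0.
Proof.
have i0 : (0 < i)%N by lia.
have [x xi xE] := bigmax_attained (gt_A L i) i0.
have [y yi yE] := bigmax_attained (gt_B L i) i0.
rewrite -/(gt_phi L i) in xE; rewrite -/(gt_eps L i) in yE.
have := gt_phi_ge L yi; have := bigmax_ge (gt_B L i) xi; rewrite -/(gt_eps L i).
by rewrite yE xE !gt_BE; lia.
Qed.

Lemma gt_f_posP L (l := gt_f_pos L i) :
  [/\ (0 < l <= i)%N, gt_A L i l = gt_phi L i &
      forall j, (l < j <= i)%N -> gt_A L i j < gt_phi L i].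
Proof.
have i0 : (0 < i)%N by lia.
have [x x_i phix] := bigmax_attained (gt_A L i) i0.
have := @last_filter_iota (fun j => gt_A L i j == gt_phi L i) 1 i x.
rewrite mem_iota [gt_phi _ _]phix eqxx /= add1n ltnS => /(_ x_i isT).
rewrite -[gt_A L i x]phix -/(gt_phi L i) -/(gt_f_pos L i) -/l => -[].
rewrite mem_iota add1n ltnS => l_i /eqP phil maxl.
split=> // j j_i; rewrite lt_neqAle gt_phi_ge ?andbT; last by lia.
by apply/negP => /maxl; rewrite mem_iota; lia.
Qed.

Lemma gt_e_posP L (l := gt_e_pos L i) :
  [/\ (0 < l <= i)%N, gt_A L i l = gt_phi L i &
      forall j, (0 < j < l)%N -> gt_A L i j < gt_phi L i].
Proof.
have i0 : (0 < i)%N by lia.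
have [x x_i epsx] := bigmax_attained (gt_B L i) i0.
have := @head_filter_iota (fun j => gt_B L i j == gt_eps L i) 1 i x.
rewrite mem_iota [gt_eps _ _]epsx eqxx /= add1n ltnS => /(_ x_i isT).
rewrite -[gt_B L i x]epsx -/(gt_eps L i) -/(gt_e_pos L i) -/l => -[].
rewrite mem_iota add1n ltnS gt_epsE => l_i /eqP epsl minl.
rewrite gt_BE in epsl; last by lia.
split=> // [|j j_i]; first by lia.
rewrite lt_neqAle gt_phi_ge ?andbT; last by lia.
apply/eqP => Aj; have := minl j; rewrite mem_iota gt_BE ?Aj ?eqxx; lia.
Qed.

Lemma gt_f_pos_uniq L l : (0 < l <= i)%N ->
    (forall j, (0 < j <= i)%N -> gt_A L i j <= gt_A L i l) ->
    (forall j, (l < j <= i)%N -> gt_A L i j < gt_A L i l) ->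
  gt_phi L i = gt_A L i l /\ gt_f_pos L i = l.
Proof.
move=> l_i lmax llast; have [p_i pE plast] := gt_f_posP L.
have phiE : gt_phi L i = gt_A L i l.
  by have := lmax _ p_i; have := gt_phi_ge L l_i; lia.
split=> //; have [lp|pl|//] := ltngtP (gt_f_pos L i) l.
  by have := plast l; lia.
by have := llast (gt_f_pos L i); lia.
Qed.

Lemma gt_e_pos_uniq L l : (0 < l <= i)%N ->
    (forall j, (0 < j <= i)%N -> gt_A L i j <= gt_A L i l) ->
    (forall j, (0 < j < l)%N -> gt_A L i j < gt_A L i l) ->
  gt_phi L i = gt_A L i l /\ gt_e_pos L i = l.
Proof.
move=> l_i lmax lfirst; have [p_i pE pfirst] := gt_e_posP L.
have phiE : gt_phi L i = gt_A L i l.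
  by have := lmax _ p_i; have := gt_phi_ge L l_i; lia.
split=> //; have [lp|pl|//] := ltngtP (gt_e_pos L i) l.
  by have := lfirst (gt_e_pos L i); lia.
by have := pfirst l; lia.
Qed.

(** The entry (i, l) occurs in a_l and in a_(l-1), both times with coefficient 1,
    so the tail sum A_j sees the change twice for j < l and once for j = l. *)
Lemma gt_A_upd L l x j : (0 < l <= i)%N -> (j <= i)%N ->
  gt_A (upd L i l x) i j =
    gt_A L i j + (x%:Z - (ent L i l)%:Z) * ((j <= l)%N%:Z + (j < l)%N%:Z).
Proof.
move=> l_i ji; set d := _ - _; have l0 : (0 < l)%N by lia.
have i0 : (0 < i)%N by lia.
have aE k : gt_a (upd L i l x) i k
    = gt_a L i k + d * ((k == l : nat)%:Z + (k == l.-1 : nat)%:Z).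
  rewrite /gt_a !ent_upd // !eqxx /=.
  have [-> ->] : (i.-1 == i) = false /\ (i.+1 == i) = false by lia.
  have -> : (k == l.-1) = (k.+1 == l) by lia.
  rewrite /d; case: (eqVneq k l) => [->|_]; last by case: (eqVneq k.+1 l) => [->|_] /=; lia.
  by rewrite (_ : (l.+1 == l) = false) /=; lia.
rewrite /gt_A (eq_bigr _ (fun k _ => aE k)) big_split /= -mulr_sumr.
congr (_ + _ * _).
by rewrite big_split /= !sum_delta; lia.
Qed.

Section Pattern.
Variable L : seq (seq nat).
Hypothesis gtpL : is_gtp n la L.

Lemma gt_phi_ge0 : 0 <= gt_phi L i.
Proof.
have ii : (0 < i <= i)%N by lia.
apply: le_trans (gt_phi_ge L ii).
rewrite gt_AS // gt_A_end /gt_a (@gtp_ent0 _ _ _ gtpL i i.+1) ?ltnSn //.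
rewrite (@gtp_ent0 _ _ _ gtpL i.-1 i); last by lia.
by have := @gtp_interlace _ _ _ gtpL i i; lia.
Qed.

Lemma gt_eps_ge0 : 0 <= gt_eps L i.
Proof.
have i1 : (0 < 1 <= i)%N by lia.
apply: le_trans (bigmax_ge (gt_B L i) i1).
rewrite /gt_B big_nat1 /gt_b /= !ent0.
by have := @gtp_interlace _ _ _ gtpL i 1; lia.
Qed.

(** Otherwise A_(l+1) >= A_l, against the choice of l as the last maximum; for
    l = i the tail sum A_(l+1) is 0. *)
Lemma gt_f_pos_a : 0 < gt_phi L i -> 0 < gt_a L i (gt_f_pos L i).
Proof.
have [l_i lE lmax] := gt_f_posP L => phi0.
have := gt_AS L (j := gt_f_pos L i); case/andP: l_i => _ li /(_ li).
have [lt|ge] := ltnP (gt_f_pos L i) i; first by have := lmax (gt_f_pos L i).+1; lia.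
by rewrite (_ : (gt_f_pos L i).+1 = i.+1) ?gt_A_end; lia.
Qed.

(** Pair the four terms of a_l so that one of the two differences is the one in
    question: by interlacing the other one is nonpositive.  So row l of the tableau
    contains a letter i, and its last one has no letter i+1 below it. *)
Lemma gt_a_gt0_room l : (0 < l <= i)%N -> 0 < gt_a L i l ->
  (ent L i.-1 l < ent L i l)%N /\ (ent L i.+1 l.+1 < ent L i l)%N.
Proof.
move=> l_i; rewrite /gt_a.
have H2 := @gtp_interlace _ _ _ gtpL i l.+1.
have H3 := @gtp_interlace _ _ _ gtpL i.-1 l.
have H5 := @gtp_ent0 _ _ _ gtpL i l.+1; have H6 := @gtp_ent0 _ _ _ gtpL i.-1 l.
by rewrite !prednK // in H3; lia.
Qed.

(** Lowering the entry at the last maximum l of A subtracts 2 from A_j for j < l,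
    1 from A_l and nothing for j > l, where A_j was at most phi - 1: so l becomes
    the first maximum, with value phi - 1, and e acts there. *)
Lemma gt_f_inv : 0 < gt_phi L i -> let L' := gt_f_arr L i in
  [/\ gt_phi L' i = gt_phi L i - 1, gt_eps L' i = gt_eps L i + 1 & gt_e_arr L' i = L].
Proof.
move=> phi0 L'; have gtpL' : is_gtp n la L' by apply: gt_f_def.
have [l_i lE lmax] := gt_f_posP L; have a0 := gt_f_pos_a phi0.
set l := gt_f_pos L i in l_i lE lmax a0.
have [_ ent1] := gt_a_gt0_room l_i a0.
have i0 : (0 < i)%N by lia.
have l0 : (0 < l)%N by lia.
have L'E : L' = upd L i l (ent L i l - 1) by [].
have AE j : (j <= i)%N ->
    gt_A L' i j = gt_A L i j - ((j <= l)%N%:Z + (j < l)%N%:Z).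
  by move=> ji; rewrite L'E gt_A_upd //; lia.
have [phiE posE] : gt_phi L' i = gt_A L' i l /\ gt_e_pos L' i = l.
  apply: gt_e_pos_uniq => // j j_i; rewrite !AE; try lia.
    have := gt_phi_ge L j_i; have := lmax j; lia.
  have := gt_phi_ge L (j := j); lia.
have phi' : gt_phi L' i = gt_phi L i - 1 by rewrite phiE AE; lia.
split=> //; first by rewrite !gt_epsE phi' AE //; lia.
apply: (gtp_ext _ gtpL) => [|i' j' _ _]; last first.
  rewrite /gt_e_arr posE ent_upd // L'E !ent_upd // !eqxx /=.
  by case: (boolP (_ && _)) => [/andP[/eqP-> /eqP->]|_]; lia.
by apply: gt_e_def => //; rewrite gt_epsE phi' AE //; have := gt_eps_ge0; rewrite gt_epsE; lia.
Qed.

(** Raising the entry at the first maximum l of A makes l the last maximum. *)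
Lemma gt_e_inv : 0 < gt_eps L i -> let L' := gt_e_arr L i in
  0 < gt_phi L' i /\ gt_f_arr L' i = L.
Proof.
move=> eps0 L'; have gtpL' : is_gtp n la L' by apply: gt_e_def.
have [l_i lE lmin] := gt_e_posP L.
set l := gt_e_pos L i in l_i lE lmin.
have i0 : (0 < i)%N by lia.
have l0 : (0 < l)%N by lia.
have L'E : L' = upd L i l (ent L i l + 1) by [].
have AE j : (j <= i)%N ->
    gt_A L' i j = gt_A L i j + ((j <= l)%N%:Z + (j < l)%N%:Z).
  by move=> ji; rewrite L'E gt_A_upd //; lia.
have [phiE posE] : gt_phi L' i = gt_A L' i l /\ gt_f_pos L' i = l.
  apply: gt_f_pos_uniq => // j j_i; rewrite !AE; try lia.
    have := gt_phi_ge L j_i; have := lmin j; lia.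
  have := gt_phi_ge L (j := j); lia.
have phi' : gt_phi L' i = gt_phi L i + 1 by rewrite phiE AE; lia.
have phi0 : 0 < gt_phi L' i by have := gt_phi_ge0; lia.
split=> //.
apply: (gtp_ext _ gtpL) => [|i' j' _ _]; first exact: gt_f_def.
rewrite /gt_f_arr posE ent_upd // L'E !ent_upd // !eqxx /=.
by case: (boolP (_ && _)) => [/andP[/eqP-> /eqP->]|_]; lia.
Qed.

End Pattern.
End RowOperators.

(** * Weights of patterns *)

(** The sizes of the rows are the coordinates in which the weight and A_0 are
    compared. *)
Definition row_sum (L : seq (seq nat)) (j : nat) : int :=
  \sum_(1 <= k < j.+1) (ent L j k)%:Z.

Lemma gt_wtE L n : gt_wt L n =
  \sum_(1 <= j < n.+1) evec n j *~ (row_sum L j - row_sum L j.-1).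
Proof.
rewrite /gt_wt !big_seq; apply: eq_bigr => j; rewrite mem_index_iota => j_n.
rewrite /row_sum prednK; last by lia.
by rewrite -!(big_morph Posz PoszD (erefl (Posz 0))).
Qed.

Lemma row_sum_upd L i l x j : (0 < l <= i)%N ->
  row_sum (upd L i l x) j
    = row_sum L j + (x%:Z - (ent L i l)%:Z) * (j == i : nat)%:Z.
Proof.
move=> l_i; have [i0 l0] : (0 < i /\ 0 < l)%N by lia.
set d := _ - _; rewrite /row_sum.
rewrite (eq_bigr (fun k => (ent L j k)%:Z + d * (j == i : nat)%:Z * (k == l : nat)%:Z)).
  rewrite big_split /= -mulr_sumr sum_delta; congr (_ + _).
  by case: eqP => [->|_]; rewrite ?mulr0 ?mul0r // (_ : (0 < l < i.+1)%N) ?mulr1.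
move=> k _; rewrite ent_upd // /d.
by case: eqP => [->|_] /=; case: eqP => [->|_] /=; lia.
Qed.

Lemma gt_wt_upd n L (i : 'I_n.-1) l x : (0 < l <= i.+1)%N ->
  gt_wt (upd L i.+1 l x) n
    = gt_wt L n + alpha i *~ (x%:Z - (ent L i.+1 l)%:Z).
Proof.
move=> l_i; rewrite !gt_wtE; set d := _ - _ : int.
have lt_i := ltn_ord i.
rewrite (eq_bigr (fun j => evec n j *~ (row_sum L j - row_sum L j.-1)
   + (evec n j *~ (j == i.+1 : nat)%:Z - evec n j *~ (j.-1 == i.+1 : nat)%:Z) *~ d)).
  rewrite big_split /= -mulrz_suml; congr (_ + _ *~ _).
  have pick m : (0 < m <= n)%N -> \sum_(1 <= j < n.+1) evec n j *~ (j == m : nat)%:Z = evec n m.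
    move=> m_n; rewrite -[RHS](sum_pick (evec n) m_n); apply: eq_bigr => j _.
    by case: eqP; rewrite ?mulr1z ?mulr0z.
  rewrite sumrB pick; last by lia.
  congr (_ - _); rewrite -[RHS]pick; last by lia.
  by rewrite !big_seq; apply: eq_bigr => -[|j].
move=> j _; rewrite !row_sum_upd // -mulrzBr -mulrzA -mulrzDr; congr (_ *~ _).
by rewrite -/d; lia.
Qed.

(** Each of the four families of terms of a_0, ..., a_i runs over a whole row, up
    to entries that vanish by convention. *)
Lemma gt_A0 n la L i : is_gtp n la L ->
  gt_A L i.+1 0 = row_sum L i.+1 - row_sum L i + row_sum L i.+1 - row_sum L i.+2.
Proof.
move=> gtpL; rewrite /gt_A /gt_a sumrB big_split sumrB /= /row_sum.
congr (_ - _ + _ - _).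
- by rewrite big_ltn // ent0 add0r.
- by rewrite big_ltn // ent0 add0r [LHS]big_nat_recr //= (gtp_ent0 gtpL) ?addr0 ?ltnSn.
- by rewrite [RHS]big_add1 [LHS]big_nat_recr //= (gtp_ent0 gtpL) ?addr0 ?ltnSn.
- by rewrite [RHS]big_add1.
Qed.

Lemma coroot_gt_wt n la L (i : 'I_n.-1) : is_gtp n la L ->
  coroot i (gt_wt L n) = gt_A L i.+1 0.
Proof.
move=> gtpL; have lt_i := ltn_ord i; rewrite (gt_A0 i gtpL).
rewrite gt_wtE raddf_sum /=.
rewrite (eq_big_seq (fun j => (row_sum L j - row_sum L j.-1) *
   ((j == i.+1 : nat)%:Z - (j == i.+2 : nat)%:Z))).
  under eq_bigr do rewrite mulrBr.
  have pick (F : nat -> int) m : (0 < m <= n)%N ->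
      \sum_(1 <= j < n.+1) F j * (j == m : nat)%:Z = F m.
    move=> m_n; rewrite -[RHS](sum_pick F m_n); apply: eq_bigr => j _.
    by case: eqP; rewrite ?mulr1 ?mulr0.
  by rewrite sumrB !pick /=; lia.
move=> j; rewrite mem_index_iota => j_n.
rewrite raddfMz /= coroot_evec; last by lia.
by rewrite -mulrzl intz !natz.
Qed.

(** * The crystal of patterns *)

(** The witness that a pattern with top row la exists. *)
Definition gt_const (n : nat) (la : seq nat) : seq (seq nat) :=
  mkseq (fun i => mkseq (fun j => part la j.+1) i.+1) n.

Lemma part_noninc la k : is_part la -> (0 < k)%N -> (part la k.+1 <= part la k)%N.
Proof.
case/andP=> la_sorted _; case: k => // k _; rewrite /part /=.
have [lt|ge] := ltnP k.+1 (size la); last by rewrite nth_default.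
exact: (sortedP 0%N la_sorted).
Qed.

Lemma ent_mkarr (F : nat -> nat -> nat) n i j : (0 < j <= i)%N -> (i <= n)%N ->
  ent (mkseq (fun i => mkseq (F i) i.+1) n) i j = F i.-1 j.-1.
Proof.
case: i => [|i]; case: j => [|j] //= ji lt_i.
by rewrite /ent /arow /part /= !nth_mkseq.
Qed.

Lemma shape_mkarr (F : nat -> nat -> nat) n :
  shape (mkseq (fun i => mkseq (F i) i.+1) n) = iota 1 n.
Proof.
rewrite /shape -map_comp -[1%N]addn0 iotaDl; apply: eq_map => i.
exact: size_mkseq.
Qed.

Lemma gt_const_gtp n la : is_part la -> is_gtp n la (gt_const n la).
Proof.
move=> la_part; apply/and3P; split.
- by rewrite shape_mkarr.
- apply/allP => i; rewrite mem_iota => i_n; apply/allP => j; rewrite mem_iota => j_i.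
  rewrite !ent_mkarr; try lia.
  rewrite !prednK ?leqnn; try lia.
  by rewrite part_noninc //; lia.
- apply/allP => j; rewrite mem_iota => j_n; rewrite ent_mkarr; try lia.
  by rewrite prednK //; lia.
Qed.

(** By [gt_f_inv] and [gt_e_inv] the operators are mutually inverse, and the
    relation between phi, eps and the weight is the identity phi - eps = A_0. *)
Lemma GTP_crystal n la : is_part la -> is_crystal (GTP n la).
Proof.
move=> la_part.
have rng (i : 'I_n.-1) : (0 < i.+1 < n)%N by have := ltn_ord i; lia.
have fE (b b' : gtp n la) (i : 'I_n.-1) : gt_f i.+1 b = Some b' ->
    0 < gt_phi (val b) i.+1 /\ val b' = gt_f_arr (val b) i.+1.
  by rewrite /gt_f; case: ifP => // phi0; case: insubP => // u _ uE [<-].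
have eE (b b' : gtp n la) (i : 'I_n.-1) : gt_e i.+1 b' = Some b ->
    0 < gt_eps (val b') i.+1 /\ val b = gt_e_arr (val b') i.+1.
  by rewrite /gt_e; case: ifP => // eps0; case: insubP => // u _ uE [<-].
split=> //=.
- by apply: inhabits; exists (gt_const n la); apply: gt_const_gtp.
- move=> b b' i; split=> [/fE[phi0 b'E]|/esym/eE[eps0 bE]].
    have [phi' eps' inv] := gt_f_inv (rng i) (valP b) phi0.
    rewrite /gt_e b'E eps' inv valK ifT //.
    by have := gt_eps_ge0 (rng i) (valP b); lia.
  have [phi' inv] := gt_e_inv (rng i) (valP b') eps0.
  by rewrite /gt_f bE phi' inv valK.
- move=> b b' i /fE[phi0 b'E].
  have [phi' eps' inv] := gt_f_inv (rng i) (valP b) phi0.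
  have [l_i lE lmax] := gt_f_posP (rng i) (val b).
  have [_ ent1] := gt_a_gt0_room (rng i) (valP b) l_i (gt_f_pos_a (rng i) (valP b) phi0).
  rewrite b'E phi' eps'; split=> //.
  rewrite /gt_f_arr gt_wt_upd // -[in RHS](mulrN1z (alpha i)); congr (_ + _ *~ _); lia.
- by move=> b i; rewrite (gt_epsE (rng i)) (coroot_gt_wt i (valP b)); congr Some; rewrite subrK.
Qed.

(** * Preliminaries on sums and diagrams *)

Lemma sum_interval (m lo hi : nat) :
  \sum_(1 <= c < m.+1) ((lo < c <= hi)%N : nat) = (minn m hi - lo)%N.
Proof.
elim: m => [|m IH]; first by rewrite big_geq //; lia.
by rewrite big_nat_recr //= IH; lia.
Qed.

Lemma sum_extend (V : nmodType) (F : nat -> V) m n : (m <= n)%N ->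
    (forall r, (m < r)%N -> F r = 0) ->
  \sum_(1 <= r < m.+1) F r = \sum_(1 <= r < n.+1) F r.
Proof.
move=> mn F0; rewrite [RHS](@big_cat_nat _ _ _ m.+1) //=.
rewrite [X in _ + X]big_nat_cond [X in _ + X]big1 ?addr0 // => r.
by rewrite andbT => /andP[mr _]; apply: F0.
Qed.

(** Entries of tableaux are determined by the rule [tab_leE], which only speaks of
    upper bounds; this turns such information into equalities. *)
Lemma eq_from_leq n a b : (a <= n)%N -> (b <= n)%N ->
  (forall k, (k <= n)%N -> (a <= k)%N = (b <= k)%N) -> a = b.
Proof.
move=> an bn ab; apply/eqP; rewrite eqn_leq; have := ab b bn; have := ab a an.
by rewrite !leqnn => <- ->.
Qed.

Lemma box_row_bound la r c : (0 < c <= part la r)%N -> (0 < r <= size la)%N.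
Proof.
case/andP=> c0 /(leq_trans c0); case: r => // r; rewrite /part /= => h.
by rewrite ltnNge; apply/negP => /(nth_default 0%N) e; rewrite e in h.
Qed.

Lemma part_le1 la r : is_part la -> (0 < r)%N -> (part la r <= part la 1)%N.
Proof.
move=> la_part; case: r => // r _; elim: r => // r IH.
exact: leq_trans (part_noninc la_part (ltn0Sn r)) IH.
Qed.

(** * The tableau of a pattern *)

Section Patterns.
Variables (n : nat) (la : seq nat).

Section OnePattern.
Variable L : seq (seq nat).
Hypothesis gtpL : is_gtp n la L.

Lemma gtp_interlace_l i j : (0 < j)%N -> (i < n)%N ->
  (ent L i.+1 j.+1 <= ent L i j)%N.
Proof.
move=> j0 lt_i; have := @gtp_interlace _ _ _ gtpL i j.
have := @gtp_ent0 _ _ _ gtpL i.+1 j.+1; lia.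
Qed.

Lemma gtp_interlace_r i j : (i < n)%N -> (ent L i j <= ent L i.+1 j)%N.
Proof.
case: j => // j lt_i; have := @gtp_interlace _ _ _ gtpL i j.+1.
have := @gtp_ent0 _ _ _ gtpL i j.+1; lia.
Qed.

Lemma gtp_mono i k j : (i <= k <= n)%N -> (ent L i j <= ent L k j)%N.
Proof.
case/andP; elim: k => [|k IH]; first by rewrite leqn0 => /eqP->.
rewrite leq_eqVlt => /predU1P[-> //|ik] kn.
by apply: leq_trans (gtp_interlace_r j kn); apply: IH; lia.
Qed.

Lemma gtp_row_mono i j k : (i < n)%N -> (0 < j <= k)%N -> (ent L i k <= ent L i j)%N.
Proof.
move=> lt_i /andP[j0]; elim: k => [|k IH]; first by rewrite leqn0 => /eqP jE; rewrite jE in j0.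
rewrite leq_eqVlt => /predU1P[-> //|jk]; apply: leq_trans (IH jk).
by apply: leq_trans (gtp_interlace_l _ lt_i); [apply: gtp_interlace_r | lia].
Qed.

Lemma row_sumE j : (j <= n)%N -> row_sum L j = \sum_(1 <= r < n.+1) (ent L j r)%:Z.
Proof. by move=> jn; apply: sum_extend => // r jr; rewrite (gtp_ent0 gtpL) ?jr. Qed.

Hypothesis la_n : (size la <= n)%N.

Lemma gtp_topE r : ent L n r = part la r.
Proof.
case: r => [|r]; first by [].
have [lt|ge] := leqP r.+1 n; first by rewrite (gtp_top gtpL).
by rewrite (gtp_ent0 gtpL) ?ge // part_oversize //; lia.
Qed.

Lemma gtp_le_part i j : (i <= n)%N -> (ent L i j <= part la j)%N.
Proof. by move=> le_i; rewrite -gtp_topE; apply: gtp_mono; rewrite le_i leqnn. Qed.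

Lemma tab_bound r c : (0 < c <= part la r)%N -> (0 < ent (tab_arr n la L) r c <= n)%N.
Proof. by move=> rc; have [] := tab_arrE gtpL la_n (box_row_bound rc) rc. Qed.

(** The rows of the pattern, seen as diagrams, are nested, and the entry of a box is
    the index of the first one that contains it. *)
Lemma tab_leE r c k : (0 < c <= part la r)%N -> (k <= n)%N ->
  (ent (tab_arr n la L) r c <= k)%N = (c <= ent L k r)%N.
Proof.
move=> rc kn; have [tn /andP[_ sk] least] := tab_arrE gtpL la_n (box_row_bound rc) rc.
apply/idP/idP => [tk|]; last exact: least.
by apply: leq_trans sk _; apply: gtp_mono; rewrite tk kn.
Qed.

Lemma tab_eqE r c k : (0 < c <= part la r)%N -> (0 < k <= n)%N ->
  (ent (tab_arr n la L) r c == k) = (ent L k.-1 r < c <= ent L k r)%N.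
Proof.
move=> rc kn; rewrite ltnNge -!tab_leE; lia.
Qed.

End OnePattern.

Hypothesis la_n : (size la <= n)%N.

(** By [tab_leE] the entry (i, j) of the pattern is the number of boxes of row j of
    the tableau with entry at most i. *)
Lemma tab_arr_inj L L' : is_gtp n la L -> is_gtp n la L' ->
  tab_arr n la L = tab_arr n la L' -> L = L'.
Proof.
move=> gL gL' TT; apply: (gtp_ext gL gL') => i j ji le_i.
have E c : (0 < c <= part la j)%N -> (c <= ent L i j)%N = (c <= ent L' i j)%N.
  by move=> cj; rewrite -(tab_leE gL la_n) // -(tab_leE gL' la_n) // TT.
have := E (ent L i j); have := E (ent L' i j); rewrite !leqnn.
have := gtp_le_part gL la_n j le_i; have := gtp_le_part gL' la_n j le_i; lia.
Qed.

(** The reading goes through the diagram by columns; the sum is rearranged by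
    rows, because the letters i of a row form an interval.  Summing up to row n
    rather than to the last row of the diagram matches the sums over rows of
    patterns. *)
Lemma sum_boxes (V : nmodType) (F : nat * nat -> V) : is_part la ->
  \sum_(b <- reading la) F b
    = \sum_(1 <= r < n.+1) \sum_(1 <= c < (part la r).+1) F (r, c).
Proof.
move=> la_part; rewrite /reading big_allpairs_dep /= (perm_big (iota 1 (part la 1))) ?perm_rev //=.
under eq_bigr do rewrite big_filter big_mkcond.
rewrite exchange_big /= -(sum_extend la_n); last first.
  by move=> r lt_r; rewrite part_oversize // big_geq.
rewrite /index_iota !subSS !subn0 !big_seq; apply: eq_bigr => r; rewrite mem_iota => r_la.
rewrite -big_mkcond /=.
have -> : part la 1 = (part la r + (part la 1 - part la r))%N.
  by rewrite subnKC // part_le1 //; lia.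
rewrite iotaD big_cat /= [X in _ + X]big_seq_cond [X in _ + X]big1 ?addr0.
  by rewrite subSS subn0 big_seq_cond [RHS]big_seq; apply: eq_bigl => c; rewrite mem_iota; lia.
by move=> c; rewrite mem_iota; lia.
Qed.

Lemma count_flatten_boxes (a : pred nat) T : shape T = la ->
  count a (flatten T)
    = \sum_(1 <= r < n.+1) \sum_(1 <= c < (part la r).+1) (a (ent T r c) : nat).
Proof.
move=> shT; have sizeT : size T = size la by rewrite -shT size_map.
rewrite count_flatten sumnE big_map (big_nth [::]) sizeT.
rewrite -(@sum_extend nat _ _ _ la_n); last first.
  by move=> r lt_r; rewrite part_oversize // big_geq.
rewrite [RHS]big_add1 !big_nat; apply: eq_bigr => r /= lt_r.
rewrite -sum1_count big_mkcond (big_nth 0%N) [RHS]big_add1 /=.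
by rewrite /part /= -shT (nth_map [::]) ?sizeT //; apply: eq_bigr => c _; case: (a _).
Qed.

(** In each row the letters k fill the interval between the entries of the rows
    k-1 and k of the pattern. *)
Lemma count_tab L k : is_gtp n la L -> (0 < k <= n)%N ->
  (count_mem k (flatten (tab_arr n la L)))%:Z = row_sum L k - row_sum L k.-1.
Proof.
move=> gtpL k_n.
rewrite (count_flatten_boxes _ (ssyt_shape (tab_arr_ssyt la_n gtpL))).
rewrite !(row_sumE gtpL) -?sumrB; try lia.
rewrite (big_morph Posz PoszD (erefl (Posz 0))); apply: eq_bigr => r _.
rewrite (eq_big_nat _ _ (F2 := fun c => ((ent L k.-1 r < c <= ent L k r)%N : nat))).
  rewrite sum_interval; have := gtp_le_part gtpL la_n r (_ : (k <= n)%N).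
  have := @gtp_mono _ gtpL k.-1 k r; lia.
by move=> c rc; rewrite /= (tab_eqE gtpL la_n) //; lia.
Qed.

Lemma tab_wt L : is_gtp n la L ->
  \sum_(1 <= k < n.+1) evec n k *+ count_mem k (flatten (tab_arr n la L))
    = gt_wt L n.
Proof.
move=> gtpL; rewrite gt_wtE !big_nat; apply: eq_bigr => k k_n.
by rewrite pmulrn count_tab.
Qed.

Lemma count_fe_word (a : pred nat) T : is_part la -> shape T = la ->
  count a (fe_word la T) = count a (flatten T).
Proof.
move=> la_part shT; rewrite (count_flatten_boxes _ shT).
rewrite -(@sum_boxes nat (fun b => (a (ent T b.1 b.2) : nat))) //.
by rewrite count_map -sum1_count big_mkcond; apply: eq_bigr => b _ /=; case: (a _).
Qed.
End Patterns.

(** * The pattern of a tableau *)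

(** In a sorted row the entries at most k come first. *)
Lemma count_leE (s : seq nat) k c : sorted leq s -> (0 < c <= size s)%N ->
  (c <= count (fun x => x <= k) s)%N = (part s c <= k)%N.
Proof.
elim: s c => [|x s IH] c sx cs; first by move: cs; rewrite /=; lia.
case: c cs => [|c] // cs.
have /allP xs := order_path_min leq_trans sx; have ss := path_sorted sx.
have [xk|kx] := leqP x k.
  rewrite /= xk add1n ltnS; case: c cs => [|c] cs; first by rewrite /part /= xk.
  exact: IH.
have -> : count (fun y => y <= k)%N (x :: s) = 0%N.
  rewrite /= leqNgt kx; apply/eqP; rewrite -leqn0 leqNgt -has_count.
  by apply/hasPn => y /xs; lia.
rewrite /part /=; case: c cs => [|c] cs; first by rewrite /=; lia.
by have := xs (nth 0%N s c) (mem_nth 0%N _); rewrite /= in cs *; lia.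
Qed.

Section Tableaux.
Variables (n : nat) (la : seq nat) (T : seq (seq nat)).
Hypotheses (la_part : is_part la) (ssytT : is_ssyt n la T).

Lemma ssyt_size : size T = size la.
Proof. by rewrite -(ssyt_shape ssytT) size_map. Qed.

Lemma ssyt_size_row r : size (arow T r) = part la r.
Proof.
case: r => [|r]; first by [].
have [lt|ge] := ltnP r (size T).
  by rewrite /arow /part -(ssyt_shape ssytT) /= (nth_map [::]).
by rewrite part_oversize -?ssyt_size // /arow /= nth_default.
Qed.

Lemma ssyt_bound r c : (0 < c <= part la r)%N -> (0 < ent T r c <= n)%N.
Proof.
move=> rc; have := box_row_bound rc; case: r rc => // r rc r_la.
case/and4P: ssytT => _ /(all_nthP [::])/(_ r) H _ _.
have /(all_nthP 0%N)/(_ c.-1) : all (fun x => 1 <= x <= n)%N (nth [::] T r).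
  by apply: H; rewrite ssyt_size; lia.
have := ssyt_size_row r.+1; rewrite /arow /= => ->.
by case: c rc => // c rc; apply; lia.
Qed.

Lemma ssyt_row_sorted r : sorted leq (arow T r).
Proof.
have [lt|ge] := ltnP r (size T).+1; last by rewrite /arow nth_default.
case: r lt => // r lt; case/and4P: ssytT => _ _ /(all_nthP [::])/(_ r) H _.
exact: H.
Qed.

Lemma ssyt_col r c : (0 < r)%N -> (0 < c <= part la r.+1)%N ->
  (ent T r c < ent T r.+1 c)%N.
Proof.
move=> r0 rc; have := box_row_bound rc => r_la.
case/and4P: ssytT => _ _ _ /allP/(_ r); rewrite mem_iota => H.
by have /allP/(_ c) := H ltac:(lia); rewrite mem_iota; apply; lia.
Qed.

(** Columns strictly increase from an entry that is at least 1.  This is why rows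
    below the k-th do not contribute to the k-th row of the pattern. *)
Lemma ssyt_ge_row r c : (0 < c <= part la r)%N -> (r <= ent T r c)%N.
Proof.
elim: r => // r IH rc; case: r IH rc => [_|r IH] rc.
  by have := ssyt_bound rc; lia.
have := part_noninc la_part (ltn0Sn r); have := ssyt_col (ltn0Sn r) rc; lia.
Qed.

(** The length of row r of the part of the tableau with entries at most k, which is
    the entry (k, r) of its pattern. *)
Definition row_count (r k : nat) : nat := count (fun x => x <= k)%N (arow T r).

Lemma row_countE r k c : (0 < c <= part la r)%N ->
  (c <= row_count r k)%N = (ent T r c <= k)%N.
Proof. by move=> rc; rewrite count_leE ?ssyt_row_sorted ?ssyt_size_row. Qed.

Lemma row_count_le r k : (row_count r k <= part la r)%N.
Proof. by rewrite -ssyt_size_row count_size. Qed.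

Definition untab_arr : seq (seq nat) :=
  mkseq (fun i => mkseq (fun j => row_count j.+1 i.+1) i.+1) n.

Lemma ent_untab i j : (0 < j <= i)%N -> (i <= n)%N ->
  ent untab_arr i j = row_count j i.
Proof. by move=> ji le_i; rewrite ent_mkarr // !prednK //; lia. Qed.

(** A box (j+1, c) with entry at most i+1 has above it a box with entry at most i,
    because columns strictly increase: this is the nontrivial interlacing
    inequality. *)
Lemma untab_arr_gtp : is_gtp n la untab_arr.
Proof.
apply/and3P; split.
- by rewrite shape_mkarr.
- apply/allP => i; rewrite mem_iota => i_n; apply/allP => j; rewrite mem_iota => j_i.
  rewrite !ent_untab; try lia.
  apply/andP; split; first by apply: sub_count => x /=; lia.
  set c := row_count j.+1 i.+1; have [->//|c0] := posnP c.
  have c_la : (0 < c <= part la j.+1)%N by rewrite c0 row_count_le.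
  have j0 : (0 < j)%N by lia.
  have c_la' : (0 < c <= part la j)%N by have := part_noninc la_part j0; lia.
  rewrite row_countE //; have := ssyt_col j0 c_la.
  have := row_countE i.+1 c_la; rewrite -/c leqnn; lia.
- apply/allP => j; rewrite mem_iota => j_n; rewrite ent_untab; try lia.
  rewrite eqn_leq row_count_le /=; set c := part la j.
  have [->//|c0] := posnP c.
  by rewrite row_countE ?c0 ?leqnn //; have := @ssyt_bound j c; rewrite c0 leqnn; lia.
Qed.

Lemma ssyt_ext T' : is_ssyt n la T' ->
    (forall r c, (0 < c <= part la r)%N -> ent T r c = ent T' r c) ->
  T = T'.
Proof.
move=> ssytT' TT; have sh := ssyt_shape ssytT; have sh' := ssyt_shape ssytT'.
have sz : size T = size T' by rewrite -(size_map size) -/(shape _) sh -sh' size_map.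
apply: (@eq_from_nth _ [::]) => // r lt_r.
have rE : size (nth [::] T r) = nth 0%N la r by rewrite -sh nth_shape.
have rE' : size (nth [::] T' r) = nth 0%N la r by rewrite -sh' nth_shape -?sz.
apply: (@eq_from_nth _ 0%N); rewrite rE ?rE' // => c lt_c.
exact: (TT r.+1 c.+1).
Qed.

Lemma untab_arrK (la_n : (size la <= n)%N) : tab_arr n la untab_arr = T.
Proof.
symmetry; apply: ssyt_ext => [|r c rc].
  exact: tab_arr_ssyt untab_arr_gtp.
have tb := tab_bound untab_arr_gtp la_n rc; have bd := ssyt_bound rc.
apply: (@eq_from_leq n); [lia | lia|] => k kn.
rewrite (tab_leE untab_arr_gtp la_n) //.
have r0 := box_row_bound rc.
have [rk|kr] := leqP r k; first by rewrite ent_untab ?row_countE //; lia.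
rewrite (gtp_ent0 untab_arr_gtp) ?kr //.
by have := ssyt_ge_row rc; lia.
Qed.

End Tableaux.

Definition untab n la (la_part : is_part la) (T : ssyt n la) : gtp n la :=
  exist _ (untab_arr n (val T)) (untab_arr_gtp la_part (valP T)).

Section Bijection.
Variables (n : nat) (la : seq nat).
Hypotheses (la_part : is_part la) (la_n : (size la <= n)%N).

Lemma untabK : cancel (untab la_part) (tab la_n).
Proof. by move=> T; apply: val_inj; apply: untab_arrK (valP T) la_n. Qed.

(** A right inverse of an injective map is also a left inverse. *)
Lemma tabK : cancel (tab la_n) (untab la_part).
Proof.
move=> L; apply: val_inj; apply: (tab_arr_inj la_n (valP _) (valP L)).
exact: (untab_arrK la_part (valP (tab la_n L)) la_n).
Qed.

End Bijection.

(** * The reading order on boxes, and heights of reading words *)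

(** The order in which the far-eastern reading visits the boxes (row, column). *)
Definition box_lt (b b' : nat * nat) : bool :=
  (b'.2 < b.2)%N || (b'.2 == b.2) && (b.1 < b'.1)%N.

Lemma box_lt_trans : transitive box_lt.
Proof. by move=> [a1 a2] [b1 b2] [c1 c2]; rewrite /box_lt /=; lia. Qed.

Lemma reading_sorted la : sorted box_lt (reading la).
Proof.
rewrite (sorted_pairwise box_lt_trans) /reading.
have : sorted gtn (rev (iota 1 (part la 1))) by rewrite rev_sorted iota_ltn_sorted.
elim: (rev _) => //= c cs IH cc; rewrite pairwise_cat IH ?(path_sorted cc) // andbT.
apply/andP; split.
  apply/allrelP => _ _ /mapP[r _ ->] /allpairsPdep[c' [r' [c'cs _ ->]]].
  have /allP/(_ _ c'cs) := order_path_min (rev_trans ltn_trans) cc.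
  by rewrite /box_lt /= => ->.
rewrite pairwise_map; set s := filter _ _.
have : sorted ltn s by apply: (sorted_filter ltn_trans); apply: iota_ltn_sorted.
rewrite (sorted_pairwise ltn_trans); apply: sub_pairwise => r r' /=.
by rewrite /box_lt /= eqxx => ->; rewrite orbT.
Qed.

Lemma reading_uniq la : uniq (reading la).
Proof.
apply: (sorted_uniq box_lt_trans _ (reading_sorted la)) => -[r c].
by rewrite /box_lt /= !ltnn andbF.
Qed.

Lemma mem_reading la r c : is_part la ->
  ((r, c) \in reading la) = (0 < c <= part la r)%N.
Proof.
move=> la_part; apply/idP/idP => [/allpairsPdep[c' [r' []]]|rc].
  by rewrite mem_rev mem_filter !mem_iota /= => c1 r1 [-> ->]; lia.
have r_la := box_row_bound rc.
have r0 : (0 < r)%N by lia.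
by apply: reading_mem => //; have := part_le1 la_part r0; lia.
Qed.

Lemma index_reading_lt la b b' : b \in reading la -> b' \in reading la ->
  (index b (reading la) < index b' (reading la))%N = box_lt b b'.
Proof.
move=> bin b'in; have lt_of := sorted_ltn_index box_lt_trans (reading_sorted la).
have [/(lt_of _ _ bin b'in)-> //|/(lt_of _ _ b'in bin)|] := ltngtP (index b _) (index b' _).
  by rewrite /box_lt; lia.
move=> /(congr1 (nth (0, 0)%N (reading la))); rewrite !nth_index // => ->.
by rewrite /box_lt; lia.
Qed.

Lemma size_fe_word la T : size (fe_word la T) = size (reading la).
Proof. by rewrite size_map. Qed.

(** Positions in the reading word are replaced by boxes: the suffix that starts at b
    consists of the boxes that do not come strictly before b. *)
Lemma word_height_fe i la T b : b \in reading la ->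
  word_height i (fe_word la T) (index b (reading la))
    = \sum_(b' <- reading la) (if box_lt b' b then 0 else bsign i (ent T b'.1 b'.2)).
Proof.
move=> bin; rewrite /word_height /height size_fe_word big_mkcond /=.
rewrite -[size (reading la)]subn0 -/(index_iota 0 _).
rewrite [RHS](big_nth (0, 0)%N) !big_nat; apply: eq_bigr => q /= lt_q.
have qin := mem_nth (0, 0)%N lt_q.
rewrite (nth_map (0, 0)%N) // -(index_reading_lt qin bin) index_uniq ?reading_uniq //.
by rewrite ltnNge; case: (_ <= _)%N.
Qed.

(** * The reading word of the tableau of a pattern *)

Section TableauWord.
Variables (n : nat) (la : seq nat) (i : nat) (L : seq (seq nat)).
Hypotheses (la_part : is_part la) (la_n : (size la <= n)%N).
Hypotheses (i_n : (0 < i < n)%N) (gtpL : is_gtp n la L).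
Let T := tab_arr n la L.
Let w := fe_word la T.
Let pos r c := index (r, c) (reading la).

Let x k := (ent L i k)%:Z - (ent L i.-1 k)%:Z.
Let y k := (ent L i.+1 k)%:Z - (ent L i k)%:Z.

(** Here x_k and y_k count the letters i and i+1 in row k of the tableau: A_j is
    the number of i in the rows from j on minus the number of i+1 in the rows
    after j.  Summing over all rows up to n makes it comparable to heights. *)
Lemma gt_A_sum j : (0 < j <= i.+1)%N -> gt_A L i j
  = \sum_(1 <= k < n.+1) ((if (j <= k)%N then x k else 0)
                           - (if (j < k)%N then y k else 0)).
Proof.
have [d] := ubnP (i.+1 - j); elim: d j => // d IH j jd j_i.
have [ji|ij] := leqP j i; last first.
  have -> : j = i.+1 by lia.
  rewrite gt_A_end big1 // => k _; rewrite /x /y.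
  by case: ifP => ik; case: ifP => ik'; rewrite ?(gtp_ent0 gtpL) //; lia.
rewrite gt_AS // (IH j.+1); try lia.
have -> : gt_a L i j = \sum_(1 <= k < n.+1)
   ((if k == j then x k else 0) - (if k == j.+1 then y k else 0)).
  by rewrite sumrB !sum_pick ?/gt_a ?/x ?/y; lia.
rewrite -big_split; apply: eq_bigr => k _ /=.
by case: (ltngtP j k) => jk; case: (eqVneq k j.+1) => kj;
  case: (ltngtP j.+1 k) => jk'; lia.
Qed.

(** Row k meets the suffix starting at box (r, c) in its first c columns, or in its
    first c - 1 columns when it is above row r; the counts are truncated
    differences because the interval of letters may start beyond that column. *)
Lemma tab_height_sum r c : (0 < c <= part la r)%N ->
  word_height i w (pos r c) = \sum_(1 <= k < n.+1)
    ((minn (ent L i k) (c - (k < r)) - ent L i.-1 k)%N%:Z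
     - (minn (ent L i.+1 k) (c - (k < r)) - ent L i k)%N%:Z).
Proof.
move=> rc; rewrite word_height_fe ?mem_reading // (sum_boxes la_n) //.
apply: eq_bigr => k _; set d := (c - (k < r))%N.
rewrite (eq_big_nat _ _ (F2 := fun c' =>
   (ent L i.-1 k < c' <= minn (ent L i k) d)%N%:Z
   - (ent L i k < c' <= minn (ent L i.+1 k) d)%N%:Z)); last first.
  move=> c' c'_k; rewrite /bsign /= !(tab_eqE gtpL la_n) /=; try lia.
  by rewrite /box_lt /d /=; case: ifP; lia.
rewrite sumrB -!(big_morph Posz PoszD (erefl (Posz 0))) !sum_interval.
have := gtp_le_part gtpL la_n k (_ : (i <= n)%N).
have := gtp_le_part gtpL la_n k (_ : (i.+1 <= n)%N).
by case/andP: i_n => _ lt_i; move=> /(_ lt_i) ? /(_ (ltnW lt_i)) ?; congr (Posz _ - Posz _); lia.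
Qed.

(** By interlacing, a row k < r has its letters i and i+1 right of column c, outside
    the suffix, and a row k > r has them in the columns up to c, except that
    some letters i+1 of row r+1 may lie beyond column c.  So the height
    differs from A_r by the letters i of row r right of column c, which are
    missing, and by those letters i+1 of row r+1. *)
Lemma tab_height r c : (0 < c <= part la r)%N -> ent T r c = i ->
  (r <= i)%N /\
  word_height i w (pos r c)
    = gt_A L i r - ((ent L i r)%:Z - (maxn c (ent L i.+1 r.+1))%:Z).
Proof.
move=> rc /eqP; rewrite (tab_eqE gtpL la_n) //; last by lia.
move=> rci; have r0 := box_row_bound rc.
have r0' : (0 < r)%N by lia.
have r_i : (r <= i)%N by rewrite leqNgt; apply/negP => ir; have := @gtp_ent0 _ _ _ gtpL i r; lia.
split=> //; rewrite tab_height_sum // gt_A_sum; last by lia.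
rewrite [RHS](_ : _ = \sum_(1 <= k < n.+1)
   (((if (r <= k)%N then x k else 0) - (if (r < k)%N then y k else 0))
    - ((if k == r then (ent L i k)%:Z - c%:Z else 0)
       - (if k == r.+1 then (ent L i.+1 k - c)%N%:Z else 0)))); last first.
  rewrite [RHS]sumrB [X in _ = _ - X]sumrB !sum_pick ?ltnS; try lia.
  by congr (_ - _); lia.
rewrite !big_nat; apply: eq_bigr => k k_n; rewrite /x /y.
have i1n : (i.-1 < n)%N by lia.
have lt_i : (i < n)%N by lia.
have iE : i.-1.+1 = i by lia.
have k0 : (0 < k)%N by lia.
have low := gtp_interlace_r gtpL k i1n; rewrite iE in low.
have up := gtp_interlace_r gtpL k lt_i.
have [kr|rk|kr] := ltngtP k r.
- have := gtp_interlace_l gtpL k0 i1n; rewrite iE.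
  have := gtp_row_mono gtpL lt_i (kr : (0 < k.+1 <= r)%N).
  have -> : (k == r.+1) = false by lia.
  by lia.
- have := gtp_interlace_l gtpL r0' i1n; rewrite iE.
  have := gtp_row_mono gtpL lt_i (rk : (0 < r.+1 <= k)%N).
  have [kE|kr1] := eqVneq k r.+1; first by subst k; lia.
  have k1 : (0 < k.-1)%N by lia.
  have rk1 : (0 < r.+1 <= k.-1)%N by lia.
  have := gtp_interlace_l gtpL k1 lt_i; have := gtp_row_mono gtpL lt_i rk1.
  by rewrite prednK //; lia.
- by rewrite kr (_ : (r == r.+1) = false); lia.
Qed.

(** Moving right past a letter other than i does not lower the height, so its
    maxima can be sought at letters i, or beyond the end of the word. *)
Lemma height_opener p : exists2 q, (p <= q)%N &
  word_height i w p <= word_height i w q /\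
  ((size w <= q)%N \/ (q < size w)%N /\ nth 0%N w q = i).
Proof.
have [d] := ubnP (size w - p); elim: d p => // d IH p pd.
have [pw|wp] := ltnP p (size w); last by exists p => //; split=> //; left.
have [pi|pi] := eqVneq (nth 0%N w p) i; first by exists p => //; split=> //; right.
have [|q pq [hq qP]] := IH p.+1; first by lia.
exists q; [by lia | split=> //; apply: le_trans hq].
by rewrite word_heightS pw /bsign (negPf pi); lia.
Qed.

Lemma reading_nth q : (q < size w)%N -> nth 0%N w q = i ->
  exists r c, [/\ (0 < c <= part la r)%N, ent T r c = i & q = pos r c].
Proof.
rewrite size_fe_word => lt_q; have qin := mem_nth (0, 0)%N lt_q.
rewrite (nth_map (0, 0)%N) //; case E : (nth _ _ q) => [r c] /= rcE.
exists r, c; rewrite -mem_reading // -E; split=> //.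
by rewrite /pos -E index_uniq ?reading_uniq.
Qed.

Lemma tab_height_le q : (q < size w)%N -> nth 0%N w q = i ->
  word_height i w q <= gt_phi L i.
Proof.
move=> lt_q /(reading_nth lt_q)[r [c [rc rcE ->]]].
have [r_i ->] := tab_height rc rcE; have r0 := box_row_bound rc.
have := rcE; move/eqP; rewrite (tab_eqE gtpL la_n) //; last by lia.
have r_i' : (0 < r <= i)%N by lia.
have r0' : (0 < r)%N by lia.
have lt_i : (i < n)%N by lia.
by have := gt_phi_ge L r_i'; have := gtp_interlace_l gtpL r0' lt_i; lia.
Qed.

Lemma tab_phi0 : gt_phi L i <= 0 -> w_phi i w = 0%N.
Proof.
move=> phi0; apply: w_phi_le0 => p.
have [q _ [hpq [wq|[lt_q qi]]]] := height_opener p; apply: le_trans hpq _.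
  by rewrite word_height_oversize.
exact: le_trans (tab_height_le lt_q qi) phi0.
Qed.

Section Lowering.
Hypothesis phi_gt0 : 0 < gt_phi L i.
Let l := gt_f_pos L i.
Let c0 := ent L i l.

(** The box that f changes is the last i of row l, where l is the last maximum of A. *)
Lemma lowering_box : [/\ (0 < l <= i)%N, (0 < c0 <= part la l)%N & ent T l c0 = i].
Proof.
have [l_i lE _] := gt_f_posP i_n L.
have [a1 a2] := gt_a_gt0_room i_n gtpL l_i (gt_f_pos_a i_n gtpL phi_gt0).
have le_i : (i <= n)%N by lia.
rewrite -/l -/c0 in l_i a1 a2.
have c0la : (0 < c0 <= part la l)%N.
  by have := gtp_le_part gtpL la_n l le_i; rewrite -/c0; lia.
split=> //; apply/eqP; rewrite (tab_eqE gtpL la_n) //; last by lia.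
by rewrite -/c0 leqnn andbT.
Qed.

(** Later letters i in the reading lie either further left in row l, where the
    defect of [tab_height] is positive, or in a lower row r > l, where A_r < A_l.
    Rows r < l are excluded: by interlacing their letters i are right of the
    ones of row l. *)
Lemma lowering_peak :
  last_peak (word_height i w) (pos l c0) /\ word_height i w (pos l c0) = gt_phi L i.
Proof.
have [l_i lE lmax] := gt_f_posP i_n L; rewrite -/l in l_i lE lmax.
have [_ a2] := gt_a_gt0_room i_n gtpL l_i (gt_f_pos_a i_n gtpL phi_gt0).
rewrite -/l -/c0 in a2.
have [_ lc lcE] := lowering_box.
have hE : word_height i w (pos l c0) = gt_phi L i.
  by have [_ ->] := tab_height lc lcE; rewrite lE -/c0; lia.
split=> //; rewrite /last_peak hE; split=> p.
  have [q _ [hpq [wq|[lt_q qi]]]] := height_opener p; apply: le_trans hpq _.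
    by rewrite word_height_oversize // ltW.
  exact: tab_height_le.
move=> lp; have [q pq [hpq [wq|[lt_q qi]]]] := height_opener p; apply: le_lt_trans hpq _.
  by rewrite word_height_oversize.
have [r [c [rc rcE qE]]] := reading_nth lt_q qi.
have := leq_trans lp pq; rewrite {pq}qE index_reading_lt ?mem_reading //.
have [r_i ->] := tab_height rc rcE; have r0 := box_row_bound rc.
have r_i' : (0 < r <= i)%N by lia.
have r0' : (0 < r)%N by lia.
have lt_i : (i < n)%N by lia.
have i1n : (i.-1 < n)%N by lia.
have iE : i.-1.+1 = i by lia.
have := gt_phi_ge L r_i'.
have := rcE; move/eqP; rewrite (tab_eqE gtpL la_n) //; last by lia.
have il := gtp_interlace_l gtpL r0' lt_i; rewrite /box_lt /= => rci.
have [rl|lr|->] := ltngtP r l.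
- have := gtp_interlace_l gtpL r0' i1n; rewrite iE.
  have := @gtp_row_mono _ _ _ gtpL i r.+1 l lt_i; rewrite -/c0; lia.
- by have := lmax r; lia.
- rewrite -/c0 lE; lia.
Qed.

(** Lowering the entry (i, l) only affects whether the last box of row l has an
    entry at most i. *)
Lemma ent_tab_lowering r c : (0 < c <= part la r)%N ->
  ent (tab_arr n la (gt_f_arr L i)) r c
    = if (r == l) && (c == c0) then i.+1 else ent T r c.
Proof.
move=> rc; have gtpL' := gt_f_def gtpL i_n phi_gt0.
have [l_i lc lcE] := lowering_box.
apply: (@eq_from_leq n).
- by have := tab_bound gtpL' la_n rc; lia.
- by have := tab_bound gtpL la_n rc; rewrite -/T; case: ifP; lia.
move=> k kn; rewrite (tab_leE gtpL' la_n) // /gt_f_arr -/l -/c0 ent_upd; try lia.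
have TE := tab_leE gtpL la_n rc kn; rewrite -/T in TE.
have [rl|rl] := eqVneq r l; rewrite ?andbF ?andbT //=.
rewrite rl in rc TE *.
have [ki|ki] := eqVneq k i.
  by rewrite ki in TE *; rewrite -/c0 in TE; case: (eqVneq c c0) => [->|cc]; lia.
case: (eqVneq c c0) TE => [->|//]; rewrite lcE => <-; lia.
Qed.

Lemma fe_word_lowering : fe_word la (tab_arr n la (gt_f_arr L i)) = w_f i w.
Proof.
have [peak _] := lowering_peak; have [_ _ headE] := w_phi_last_peak peak.
have [l_i lc lcE] := lowering_box.
have lin : (l, c0) \in reading la by rewrite mem_reading.
rewrite /w_f headE; apply: (@eq_from_nth _ 0%N).
  by rewrite size_set_nth /w !size_fe_word; apply/esym/maxn_idPr; rewrite /pos index_mem.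
move=> q; rewrite size_fe_word => lt_q; have qin := mem_nth (0, 0)%N lt_q.
rewrite nth_set_nth /= !(nth_map (0, 0)%N) // -/w.
have qE := index_uniq (0, 0)%N lt_q (reading_uniq la).
case E: (nth _ _ q) qin qE => [r c] rcin /= qE.
rewrite ent_tab_lowering -?mem_reading //; congr (if _ then _ else _).
rewrite -xpair_eqE -qE /pos; apply/eqP/eqP => [->//|].
exact: (index_inj (0, 0)%N).
Qed.
End Lowering.
End TableauWord.

(** * The isomorphism of crystals *)

Section Isomorphism.
Variables (n : nat) (la : seq nat).
Hypotheses (la_part : is_part la) (la_n : (size la <= n)%N).
Let tabm := tab la_n.

Lemma far_east_tab_phi i (L : gtp n la) : (0 < i < n)%N ->
  (w_phi i (far_east (tabm L)))%:Z = gt_phi (val L) i.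
Proof.
move=> i_n; have phi0 := gt_phi_ge0 i_n (valP L).
have [phi_gt0|phi_le0] := ltrP 0 (gt_phi (val L) i).
  have [peak hE] := lowering_peak la_part la_n i_n (valP L) phi_gt0.
  by have [-> _ _] := w_phi_last_peak peak.
by rewrite (tab_phi0 la_part la_n i_n (valP L) phi_le0); lia.
Qed.

Lemma yt_f_tab i (L : gtp n la) : (0 < i < n)%N ->
  yt_f i (tabm L) = omap tabm (gt_f i L).
Proof.
move=> i_n; rewrite /yt_f /gt_f -ltz_nat far_east_tab_phi //.
case: ifP => // phi_gt0; rewrite insubT; first exact: gt_f_def (valP L) i_n phi_gt0.
move=> gtpL' /=; apply/(far_east_invP _ _ la_part).
exact: fe_word_lowering la_part la_n i_n (valP L) phi_gt0.
Qed.

Lemma tab_wtE (L : gtp n la) : yt_wt (tabm L) = gt_wt (val L) n.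
Proof. by rewrite -(tab_wt la_n (valP L)). Qed.

(** The equality of eps follows from that of phi, since phi - eps is determined by
    the numbers of letters i and i+1, hence by the row sums of the pattern. *)
Lemma tab_stat (L : GTP n la) (i : 'I_n.-1) :
  [/\ wt (tabm L : SSYT n la) = wt L, phi i (tabm L : SSYT n la) = phi i L,
      eps i (tabm L : SSYT n la) = eps i L &
      f_ i (tabm L : SSYT n la) = omap tabm (f_ i L)].
Proof.
have i_n : (0 < i.+1 < n)%N by have := ltn_ord i; lia.
have phiE := far_east_tab_phi L i_n.
have epsE : (w_eps i.+1 (far_east (tabm L)))%:Z = gt_eps (val L) i.+1.
  have := w_phi_eps i.+1 (far_east (tabm L)).
  have shT := ssyt_shape (valP (tabm L)).
  rewrite phiE (gt_epsE i_n) (gt_A0 i (valP L)) word_height0.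
  rewrite !(count_fe_word la_n) // !(count_tab la_n (valP L)) /=; lia.
split=> /=; first exact: tab_wtE.
- by rewrite phiE.
- by rewrite epsE.
- exact: yt_f_tab.
Qed.

(** Since the reading is injective on tableaux, it is enough that e and f are
    inverse to each other on words. *)
Lemma SSYT_crystal_fe (T T' : SSYT n la) i : f_ i T = Some T' <-> Some T = e_ i T'.
Proof.
rewrite /= /yt_f /yt_e; split.
  case: ifP => // phi0 /(far_east_invP _ _ la_part) T'E.
  have [eps0 inv] := w_fK phi0; rewrite T'E eps0 inv.
  by symmetry; apply/(far_east_invP _ _ la_part).
case: ifP => // eps0 /esym/(far_east_invP _ _ la_part) TE.
have [phi0 inv] := w_eK eps0; rewrite TE phi0 inv.
exact/(far_east_invP _ _ la_part).
Qed.

(** Every tableau comes from a pattern, so the axioms on weights, eps and phi are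
    carried over from patterns by [tab_stat]. *)
Lemma SSYT_crystal : is_crystal (SSYT n la).
Proof.
have [[L0] _ GTarrow GTphi _] := GTP_crystal n la_part.
have tabP T : exists L, T = tabm L by exists (untab la_part T); rewrite /tabm untabK.
split.
- exact: (inhabits (tabm L0)).
- exact: SSYT_crystal_fe.
- move=> T T' i; have [L ->] := tabP T; rewrite /arrow.
  have [wtE phiE epsE ->] := tab_stat L i.
  case fE : (@f_ n (GTP n la) i L) => [L'|] // [<-].
  have [wtE' phiE' epsE' _] := tab_stat L' i.
  by rewrite wtE phiE epsE wtE' phiE' epsE'; apply: GTarrow.
- move=> T i; have [L ->] := tabP T; have [-> -> -> _] := tab_stat L i.
  exact: GTphi.
- by move=> T i.
Qed.

Lemma tab_isomorphism : @crystal_isomorphism n (GTP n la) (SSYT n la)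
    (omap tabm : option (GTP n la) -> option (SSYT n la)).
Proof.
split; last first.
  exists (omap (untab la_part)); case=> //= x; congr Some.
    exact: tabK.
  exact: untabK.
split=> //.
- move=> L T [<-]; split=> [|i]; last by have [_ -> -> _] := tab_stat L i.
  exact: tab_wtE.
- move=> L L' T T' i [<-] [<-]; rewrite /arrow => fE.
  by have [_ _ _ ->] := tab_stat L i; rewrite fE.
Qed.
End Isomorphism.

Theorem theorem4p2 (n : nat) (la : seq nat) (n_gt0 : (0 < n)%N)
    (la_part : is_part la) (la_n : (size la <= n)%N) :
  is_crystal (GTP n la) /\ is_crystal (SSYT n la) /\
  @crystal_isomorphism n (GTP n la) (SSYT n la)
    (omap (tab la_n) : option (GTP n la) -> option (SSYT n la)).
Proof.
split; first exact: GTP_crystal.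
by split; [apply: SSYT_crystal | apply: tab_isomorphism].
Qed.
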